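(* Let $\lambda=(\lambda_1,\ldots,\lambda_{l(\lambda)})$ be an integer partition with $m_1(\lambda)=0$. Then $b_\lambda(\mathrm{Td})=0$ unless $|\lambda|$ is even. If $|\lambda|$ is even, then $$b_\lambda(\mathrm{Td})=\frac{(-1)^{l(\lambda)-\frac{|\lambda|}{2}}}{(2\pi)^{|\lambda|}\cdot\prod_i m_i(\lambda)!}\sum_{\substack{\pi\in\Pi_{l(\lambda)}\\ \text{all }\lambda_{\pi_i}\text{ even}}}\left\{2^{l(\pi)}\cdot\prod_{i=1}^{l(\pi)}\left[(|\pi_i|-1)!\cdot\zeta(\lambda_{\pi_i})\right]\right\}.$$ In particular, when $|\lambda|$ is even and $m_1(\lambda)=0$, $b_\lambda(\mathrm{Td})$ is nonzero with sign $(-1)^{l(\lambda)-\frac{|\lambda|}{2}}$.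
   Context: An integer partition $\lambda=(\lambda_1,\ldots,\lambda_{l})$ is a finite sequence of positive integers $\lambda_1\ge\cdots\ge\lambda_l\ge1$; $l(\lambda)=l$ is its length, $|\lambda|=\sum_i\lambda_i$ its weight, and $m_i(\lambda)$ is the number of parts equal to $i$; $0!:=1$. $\Pi_r$ denotes the set of all partitions of the set $\{1,\ldots,r\}$ into disjoint nonempty blocks; for $\pi=\{\pi_1,\ldots,\pi_{l(\pi)}\}\in\Pi_r$, the $\pi_i$ are its blocks and $l(\pi)$ is the number of blocks; for $\pi\in\Pi_{l(\lambda)}$, $\lambda_{\pi_i}:=\sum_{j\in\pi_i}\lambda_j$. Complex genera: a complex genus $\varphi$ corresponds to a formal power series $Q(x)=1+\sum_{i\ge1}a_ix^i$. The coefficients $b_\lambda(\varphi)$, indexed by integer partitions $\lambda$, are defined by the expansion $$\prod_{i=1}^\infty Q(x_i)=1+\sum_{|\lambda|\ge1}b_\lambda(\varphi)\,e_\lambda(\mathbf{x}),\qquad e_\lambda=\prod_{i=1}^{l(\lambda)}e_{\lambda_i},$$ where $e_k=e_k(x_1,x_2,\ldots)$ is the $k$-th elementary symmetric function in countably many commuting variables. (So $b_\lambda(\varphi)$ is the coefficient of the Chern number $C_\lambda[M]$ in $\varphi(M)$, for compact almost-complex $M$ of real dimension $2|\lambda|$.) The Todd genus $\mathrm{Td}$ is the complex genus with $Q(x)=\frac{x}{1-e^{-x}}$. $\zeta(t)=\sum_{n\ge1}n^{-t}$ for $t>1$. *)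

(* Defs.v *)
From HB Require Import structures.
From mathcomp Require Import all_boot all_order all_algebra.
From mathcomp Require Import finmap.
From mathcomp Require Import all_classical all_reals all_analysis.

Set Implicit Arguments.
Unset Strict Implicit.
Unset Printing Implicit Defensive.

Import Order.TTheory GRing.Theory Num.Theory.
Import numFieldNormedType.Exports.
Local Open Scope classical_set_scope.
Local Open Scope ring_scope.

(** * Integer partitions *)

Definition is_intpart (s : seq nat) : bool := sorted geq s && all (leq 1) s.

Record intpart := IntPart { parts :> seq nat; _ : is_intpart parts }.

HB.instance Definition _ := [isSub for parts].
HB.instance Definition _ := [Choice of intpart by <:].

Definition part_weight (la : intpart) : nat := sumn la.
Definition part_mult (i : nat) (la : intpart) : nat := count_mem i la.

(* The value la_B for a set B of positions of la.  Positions are numbered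
   from 0, i.e. they live in 'I_(size la) instead of {1, ..., l(la)}. *)
Definition block_weight (la : intpart) (B : {set 'I_(size la)}) : nat :=
  (\sum_(j in B) nth 0 la j)%N.

(** * Formal power series in countably many commuting variables *)

(* A monomial is its finitely supported exponent function; a power series is
   its family of coefficients. *)
Definition monomial := {fsfun nat -> nat with 0%N}.

Definition mdegree (m : monomial) : nat := (\sum_(i <- finsupp m) m i)%N.

Definition mfactors (m : monomial) : set (monomial * monomial) :=
  [set p : monomial * monomial | forall i, (p.1 i + p.2 i)%N = m i].

Section MultivariateSeries.
Context {R : realType}.

Definition mseries := monomial -> R.

Definition mseries_one : mseries := fun m => (finsupp m == fset0)%:R.

(* The sum has finitely many terms, see finite_mfactors below. *)
Definition mseries_mul (f g : mseries) : mseries :=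
  fun m => \sum_(p \in mfactors m) f p.1 * g p.2.

(* e_k is the sum of all squarefree monomials of degree k. *)
Definition elem_sym (k : nat) : mseries :=
  fun m => ((#|` finsupp m| == k) && all (fun i => m i == 1%N) (finsupp m))%:R.

Definition elem_sym_part (la : intpart) : mseries :=
  \big[mseries_mul/mseries_one]_(k <- la) elem_sym k.

(* The series prod_i Q(x_i), for Q with constant term 1: the monomial
   prod_i x_i^(m_i) arises only by picking the term of degree m_i in Q(x_i)
   for each i, and the factors with m_i = 0 contribute 1. *)
Definition prod_series (Q : nat -> R) : mseries :=
  fun m => \prod_(i <- finsupp m) Q (m i).

End MultivariateSeries.
Arguments mseries : clear implicits.

(** * Complex genera and the coefficients b_lambda *)

Record complex_genus (R : realType) := ComplexGenus {
  char_series :> nat -> R;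
  _ : char_series 0%N = 1 }.

(* The constant term 1 of the expansion is the term of the empty partition,
   which forces b of the empty partition to be 1.  Only the la of weight
   mdegree m contribute, so the sum is finite: see finite_expansion below. *)
Definition chern_expansion (R : realType) (phi : complex_genus R)
    (b : intpart -> R) : Prop :=
  forall m : monomial,
    prod_series phi m = \sum_(la \in [set: intpart]) b la * elem_sym_part la m.

(* Exactly one family b satisfies the expansion, because the e_la with
   |la| = d form a basis of the symmetric functions of degree d; the default
   value (fun=> 0) of xget is never used. *)
Definition chern_coef (R : realType) (phi : complex_genus R) : intpart -> R :=
  xget (fun=> 0) [set b : intpart -> R | chern_expansion phi b].

(** * The Todd genus *)

Definition fps_mul (R : realType) (f g : nat -> R) : nat -> R :=
  fun n => \sum_(i < n.+1) f i * g (n - i)%N.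

(* [:: g_0; ...; g_n] for g the inverse of f, by the usual recursion
   g_n = - (f_1 g_(n-1) + ... + f_n g_0) / f_0. *)
Fixpoint fps_inv_seq (R : realType) (f : nat -> R) (n : nat) : seq R :=
  if n is n'.+1 then
    let s := fps_inv_seq f n' in
    rcons s (- (\sum_(j < n'.+1) s`_j * f (n'.+1 - j)%N) / f 0%N)
  else [:: (f 0%N)^-1].

Definition fps_inv (R : realType) (f : nat -> R) : nat -> R :=
  fun n => (fps_inv_seq f n)`_n.

(* The series (1 - e^(-x)) / x. *)
Definition todd_denom (R : realType) : nat -> R :=
  fun k => (-1) ^+ k / (k.+1)`!%:R.

Definition todd_series (R : realType) : nat -> R := fps_inv (todd_denom R).

Lemma todd_series0 (R : realType) : todd_series R 0%N = 1.
Proof. by rewrite /todd_series /fps_inv /= /todd_denom expr0 divr1 invr1. Qed.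

Definition Td (R : realType) : complex_genus R :=
  ComplexGenus (todd_series0 R).

(** * The zeta function, for real t > 1 *)

Definition zeta (R : realType) (t : R) : R :=
  limn (series (fun n : nat => n.+1%:R `^ (- t))).

(** * Adequacy of the definitions above *)

Lemma size_fps_inv_seq (R : realType) (f : nat -> R) n :
  size (fps_inv_seq f n) = n.+1.
Proof. by elim: n => //= n IH; rewrite size_rcons IH. Qed.

Lemma nth_fps_inv_seq (R : realType) (f : nat -> R) n j :
  (j <= n)%N -> (fps_inv_seq f n)`_j = fps_inv f j.
Proof.
elim: n => [|n IH]; first by rewrite leqn0 => /eqP ->.
rewrite leq_eqVlt => /orP[/eqP -> //|]; rewrite ltnS => jn.
by rewrite /= nth_rcons size_fps_inv_seq ltnS jn IH.
Qed.

Lemma fps_mulVf (R : realType) (f : nat -> R) n :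
  f 0%N != 0 -> fps_mul (fps_inv f) f n = (n == 0%N)%:R.
Proof.
move=> f0; rewrite /fps_mul; case: n => [|n].
  by rewrite big_ord1 /fps_inv /= mulVf.
rewrite big_ord_recr /= subnn {2}/fps_inv /= nth_rcons size_fps_inv_seq.
rewrite ltnn eqxx mulfVK //; apply/eqP; rewrite subr_eq0; apply/eqP.
by apply: eq_bigr => j _; rewrite nth_fps_inv_seq // -ltnS.
Qed.

(* Q(x) (1 - e^(-x)) = x. *)
Lemma todd_seriesP (R : realType) n :
  fps_mul (todd_series R) (fun k => (k == 0%N)%:R - exp_coeff (-1) k) n
  = (n == 1%N)%:R.
Proof.
rewrite /fps_mul big_ord_recr /= subnn /exp_coeff /= expr0 divr1 subrr mulr0.
rewrite addr0; case: n => [|n]; first by rewrite big_ord0.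
rewrite eqSS -(fps_mulVf (f := todd_denom R)); last first.
  by rewrite /todd_denom expr0 divr1 oner_neq0.
apply: eq_bigr => i _; rewrite subSn 1?leq_ord //=; congr (_ * _).
by rewrite /todd_denom sub0r exprS mulN1r mulNr opprK.
Qed.

Lemma finite_mfactors m : finite_set (mfactors m).
Proof.
pose E := {ffun finsupp m -> 'I_(mdegree m).+1}.
pose mk (f : E) : monomial := [fsfun i : finsupp m => f i : nat].
have -> : mfactors m =
    mfactors m `&` range (fun p : E * E => (mk p.1, mk p.2)).
  apply/esym/setIidPl => -[p q] /= pqm.
  have mkE (r : monomial) : (forall i, (r i <= m i)%N) -> exists f, mk f = r.
    move=> rm; exists [ffun i => inord (r (val i))].
    apply/fsfunP => i; rewrite /mk fsfun_ffun; case: insubP => [u iu ui|iN].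
      rewrite /= ffunE ui inordK// ltnS (leq_trans (rm i))//.
      by rewrite /mdegree (big_fsetD1 i)//= leq_addr.
    by apply/esym/eqP; rewrite /= -leqn0 (leq_trans (rm i))// (fsfun_dflt iN).
  have [f fp] : exists f, mk f = p by apply: mkE => i; rewrite -pqm leq_addr.
  have [g gq] : exists g, mk g = q by apply: mkE => i; rewrite -pqm leq_addl.
  by exists (f, g) => //=; rewrite fp gq.
by apply: finite_setIr; apply: finite_image; exact: finite_finset.
Qed.

Lemma mdegreeD m p : mfactors m p -> mdegree m = (mdegree p.1 + mdegree p.2)%N.
Proof.
move=> pm; have degE (S : {fset nat}) (r : monomial) :
    (finsupp r `<=` S)%fset -> mdegree r = (\sum_(i <- S) r i)%N.
  move=> rS; rewrite /mdegree; apply: big_fset_incl => // i _ iN.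
  exact: fsfun_dflt.
pose S := (finsupp m `|` finsupp p.1 `|` finsupp p.2)%fset.
rewrite !(degE S) ?fsubsetUr//; last 2 first.
- by rewrite /S -fsetUA fsetUCA fsubsetUl.
- by rewrite /S -fsetUA fsubsetUl.
by rewrite -big_split; apply: eq_bigr => i _ /=; rewrite pm.
Qed.

Lemma elem_sym_part_homog (R : realType) (la : intpart) m :
  elem_sym_part la m != 0 :> R -> mdegree m = part_weight la.
Proof.
rewrite /elem_sym_part /part_weight; elim: (parts la) m => [|k s IH] m.
  rewrite big_nil /mseries_one pnatr_eq0 eqb0 negbK => /eqP m0.
  by rewrite /mdegree m0 big_seq_fset0.
rewrite big_cons /mseries_mul => nz.
have [p [pm]] : exists p, mfactors m p /\ elem_sym k p.1 *
    (\big[mseries_mul/mseries_one]_(j <- s) elem_sym j) p.2 != 0 :> R.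
  apply: contrapT => /forallNP Np; move/eqP: nz; apply.
  by apply: fsbig1 => p pm; apply: contrapT => /eqP nz; exact: (Np p).
rewrite mulf_eq0 negb_or => /andP[e1 /IH e2].
rewrite (mdegreeD pm) e2 /=; congr (_ + _)%N.
move: e1; rewrite /elem_sym pnatr_eq0 eqb0 negbK => /andP[/eqP <- /allP a1].
rewrite /mdegree big_seq (eq_bigr (fun=> 1%N)); last by move=> i /a1/eqP.
by rewrite -big_seq sum1_size.
Qed.

Lemma finite_part_weight n : finite_set [set la | part_weight la = n].
Proof.
pose E := {i : 'I_n.+1 & i.-tuple 'I_n.+1}.
pose val_seq (t : E) : seq nat := [seq val j | j <- tagged t].
have : finite_set (parts @` [set la | part_weight la = n]).
  apply: (@sub_finite_set _ _ (range val_seq)); last first.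
    by apply: finite_image; exact: finite_finset.
  move=> _ [[s sP] /= + <-]; rewrite /part_weight /= => wn.
  have /andP[_ s1] := sP.
  have szn : (size s < n.+1)%N.
    rewrite ltnS -wn; elim: s s1 {wn sP} => [|k s IH] //= /andP[k1 /IH].
    by move=> sk; rewrite -add1n; exact: leq_add.
  have sn j : j \in s -> (j < n.+1)%N.
    rewrite ltnS -wn; elim: s {s1 sP wn szn} => //= k s IH.
    rewrite inE => /orP[/eqP ->|/IH js]; first exact: leq_addr.
    by rewrite (leq_trans js) ?leq_addl.
  have szt : size [seq inord j : 'I_n.+1 | j <- s] == Ordinal szn.
    by rewrite size_map.
  exists (Tagged (fun i : 'I_n.+1 => i.-tuple 'I_n.+1) (Tuple szt)) => //.
  rewrite /val_seq /= -map_comp -[RHS]map_id; apply/eq_in_map => j js /=.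
  by rewrite inordK ?sn.
case=> k sk; exists k; rewrite -(card_eql (inj_card_eq (f := parts) _))//.
by move=> x y _ _; exact: val_inj.
Qed.

Lemma finite_expansion (R : realType) (b : intpart -> R) m :
  finite_set [set la | b la * elem_sym_part la m != 0].
Proof.
apply: sub_finite_set (finite_part_weight (mdegree m)) => la /=.
by rewrite mulf_eq0 negb_or => /andP[_ /elem_sym_part_homog].
Qed.

(* Main.v *)
Require Import Defs.
From mathcomp Require Import all_boot all_order all_algebra.
From mathcomp Require Import finmap.
From mathcomp Require Import all_classical all_reals all_analysis.
From mathcomp Require Import zify ring lra fintype finset.

(** The coefficients b_la are read off from the exponential generating series
of the genus.  Write H for the series prod_i Q(x_i), expressed in the
variables y_k = e_k.  The numbers b_la * prod_i m_i(la)! are the partial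
derivatives of H at the origin, so one works with the family of all iterated
derivatives, a function on words: the word [:: a_1; ...; a_n] stands for the
derivative with respect to y_(a_1 + 1), ..., y_(a_n + 1).  The shift by one
makes every word meaningful, since parts are at least 1.  In this language the
product of series is the shuffle product, and adjoining one more variable x_0
is the substitution y_k -> y_k + x_0 y_(k-1) with y_0 = 1, because
e_k(x_0, x) = e_k(x) + x_0 e_(k-1)(x).  Adjoining the variables of a monomial
one after the other gives its coefficient ([sym_coef]).

Two facts follow.  A symmetric function on words is determined by all the
coefficients [sym_coef] ([perm_inv_sym_coef_inj]), and it is the combination
of the e_la with the expected coefficients ([sym_coef_perm_inv]).  Hence b is
unique, and it suffices to exhibit it.

If x Q'(x) / Q(x) has coefficients (-1)^k h_k, then log H is the sum over k of
h_k times the coefficient of t^k in - log(1 + y_1 t + y_2 t^2 + ...), whose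
derivative along a word of length n and weight k is (-1)^n (n-1)! h_k
([log_series]).  The derivatives of its exponential are the sums over set
partitions of the products of these numbers over the blocks
([exp_series_partition]).  That this exponential is H needs no power sums:
adjoining a variable to order j leaves the logarithm unchanged apart from its
constant term, hence multiplies the exponential by the coefficient of x^j in Q
([adjoin_exp_log_series]).  This gives b for every genus
([chern_coef_set_partitions]).

For the Todd genus, Q(x) = e^(x/2) (x/2) / sinh(x/2), and h is given by the
values of zeta at even integers.  This is the argument of Cauchy.  For
N = 2M + 1, the expansion of sin(N theta) in powers of tan(theta) shows that
((1 + z/N)^N - (1 - z/N)^N) / (2z) is the product over r = 1, ..., M of
1 + z^2 / (N tan(pi r / N))^2.  Newton's identities relate its coefficients to
the power sums of 1 / (N tan(pi r / N))^2.  As M grows, the coefficients tend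
to those of sinh(z) / z, and the power sums to zeta(2j) / pi^(2j) because
1/theta^2 - 1 <= cot(theta)^2 <= 1/theta^2 ([zeta_newton]).  Thus h_1 = -1/2
and h_k = 0 for odd k > 1.  When la has no part equal to 1, every block has
weight at least 2, and only the set partitions into blocks of even weight
contribute; all their terms have the same sign, and the partition with at
most one block occurs, so the sum does not vanish. *)

Set Implicit Arguments.
Unset Strict Implicit.
Unset Printing Implicit Defensive.

Import Order.TTheory GRing.Theory Num.Theory.
Import numFieldNormedType.Exports.
Local Open Scope ring_scope.

(** * Shuffle algebra of functions on words *)

Section Shuffle.
Context {R : numFieldType}.
Implicit Types (f g : seq nat -> R) (s : seq nat).

Definition lderiv a f : seq nat -> R := fun s => f (a :: s).

(** The letter a stands for the part a + 1. *)
Definition lweight s := sumn [seq a.+1 | a <- s].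

Lemma lweight_cons a s : lweight (a :: s) = (a.+1 + lweight s)%N.
Proof. by []. Qed.

Lemma lweight_nseq0 n : lweight (nseq n 0%N) = n.
Proof. by rewrite /lweight map_nseq sumn_nseq mul1n. Qed.

(** The Leibniz rule for the derivative along the first letter; a word is the
list of variables along which a series is differentiated at the origin, so
this is the product of series. *)
Fixpoint shuffle f g s : R :=
  if s is a :: s' then shuffle (lderiv a f) g s' + shuffle f (lderiv a g) s'
  else f [::] * g [::].

(** The coefficient of x_0^j after the substitution y_k -> y_k + x_0 y_(k-1).
By the chain rule the derivative along y_k becomes the sum of those along
y_k and, with a factor x_0, y_(k+1).  At the origin the new argument is
(x_0, 0, 0, ...), as y_0 = 1, and the Taylor expansion in y_1 remains. *)
Fixpoint adjoin (j : nat) f s : R :=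
  if s is a :: s' then
    adjoin j (lderiv a f) s'
      + (if j is j'.+1 then adjoin j' (lderiv a.+1 f) s' else 0)
  else f (nseq j 0%N) / j`!%:R.

Lemma eq_shuffle f f' g g' s :
    (forall t, (size t <= size s)%N -> f t = f' t) ->
    (forall t, (size t <= size s)%N -> g t = g' t) ->
  shuffle f g s = shuffle f' g' s.
Proof.
elim: s f f' g g' => [|a s IH] f f' g g' ff' gg' /=; first by rewrite ff' ?gg'.
by congr (_ + _); apply: IH => t ts; rewrite /lderiv ?ff' ?gg' //= ltnW.
Qed.

Lemma shuffleDl f f' g s :
  shuffle (fun t => f t + f' t) g s = shuffle f g s + shuffle f' g s.
Proof.
elim: s f f' g => [|a s IH] f f' g /=; first by rewrite mulrDl.
rewrite -[lderiv a (fun t => f t + f' t)]/(fun t => lderiv a f t + lderiv a f' t).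
by rewrite !IH addrACA.
Qed.

Lemma shuffleDr f g g' s :
  shuffle f (fun t => g t + g' t) s = shuffle f g s + shuffle f g' s.
Proof.
elim: s f g g' => [|a s IH] f g g' /=; first by rewrite mulrDr.
rewrite -[lderiv a (fun t => g t + g' t)]/(fun t => lderiv a g t + lderiv a g' t).
by rewrite !IH addrACA.
Qed.

Lemma shuffleZl c f g s : shuffle (fun t => c * f t) g s = c * shuffle f g s.
Proof.
elim: s f g => [|a s IH] f g /=; first by rewrite mulrA.
by rewrite -[lderiv a (fun t => c * f t)]/(fun t => c * lderiv a f t) !IH mulrDr.
Qed.

Lemma shuffleZr c f g s : shuffle f (fun t => c * g t) s = c * shuffle f g s.
Proof.
elim: s f g => [|a s IH] f g /=; first by rewrite mulrCA.
by rewrite -[lderiv a (fun t => c * g t)]/(fun t => c * lderiv a g t) !IH mulrDr.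
Qed.

Lemma shuffle0l f g s : (forall t, f t = 0) -> shuffle f g s = 0.
Proof.
move=> f0; rewrite (@eq_shuffle _ (fun t => 0 * f t) _ g)//; last first.
  by move=> t _; rewrite f0 mul0r.
by rewrite shuffleZl mul0r.
Qed.

Lemma shuffle0r f g s : (forall t, g t = 0) -> shuffle f g s = 0.
Proof.
move=> g0; rewrite (@eq_shuffle _ f _ (fun t => 0 * g t))//; last first.
  by move=> t _; rewrite g0 mul0r.
by rewrite shuffleZr mul0r.
Qed.

Lemma eq_adjoin_weight j f f' s :
    (forall t, lweight t = (lweight s + j)%N -> f t = f' t) ->
  adjoin j f s = adjoin j f' s.
Proof.
elim: s j f f' => [|a s IH] j f f' ff' /=.
  by rewrite ff' // lweight_nseq0.
congr (_ + _); last case: j ff' => // j ff'; apply: IH => t ts; apply: ff'.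
  by rewrite lweight_cons ts lweight_cons addnA.
by rewrite !lweight_cons ts; lia.
Qed.

Lemma eq_adjoin j f f' s : f =1 f' -> adjoin j f s = adjoin j f' s.
Proof. by move=> ff'; apply: eq_adjoin_weight => t _. Qed.

Lemma adjoinD j f f' s :
  adjoin j (fun t => f t + f' t) s = adjoin j f s + adjoin j f' s.
Proof.
elim: s j f f' => [|a s IH] j f f' /=; first by rewrite mulrDl.
rewrite -[lderiv a (fun t => f t + f' t)]/(fun t => lderiv a f t + lderiv a f' t) IH.
case: j => [|j]; first by rewrite !addr0.
by rewrite -[lderiv a.+1 _]/(fun t => lderiv a.+1 f t + lderiv a.+1 f' t) IH addrACA.
Qed.

Lemma adjoinZ j c f s : adjoin j (fun t => c * f t) s = c * adjoin j f s.
Proof.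
elim: s j f => [|a s IH] j f /=; first by rewrite mulrA.
rewrite -[lderiv a (fun t => c * f t)]/(fun t => c * lderiv a f t) IH mulrDr.
case: j => [|j]; first by rewrite mulr0.
by rewrite -[lderiv a.+1 _]/(fun t => c * lderiv a.+1 f t) IH.
Qed.

Lemma adjoin0 f s : adjoin 0 f s = f s.
Proof. by elim: s f => [|a s IH] f /=; rewrite ?divr1 // IH addr0. Qed.

(** Taylor coefficients along one variable multiply by convolution.  The factor
j + 1 in the induction step splits as i + (j + 1 - i), one part for each
term of the Leibniz rule. *)
Lemma shuffle_nseq j f g :
  shuffle f g (nseq j 0%N) / j`!%:R =
    \sum_(i < j.+1) (f (nseq i 0%N) / i`!%:R)
      * (g (nseq (j - i)%N 0%N) / (j - i)`!%:R).
Proof.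
have lderivE (h : seq nat -> R) i :
    lderiv 0 h (nseq i 0%N) / i`!%:R = i.+1%:R * (h (nseq i.+1 0%N) / i.+1`!%:R).
  by rewrite /lderiv /= factS natrM invfM (mulrCA (h _)) mulVKf ?pnatr_eq0.
elim: j f g => [|j IH] f g; first by rewrite big_ord1 /= !divr1.
apply: (@mulfI _ j.+1%:R); first by rewrite pnatr_eq0.
rewrite -lderivE /= {1}/lderiv /= mulrDl !IH.
rewrite (eq_bigr (fun i : 'I_j.+1 => i.+1%:R * (f (nseq i.+1 0%N) / i.+1`!%:R)
      * (g (nseq (j - i)%N 0%N) / (j - i)`!%:R))); last by move=> i _; rewrite lderivE.
rewrite [X in _ + X](eq_bigr (fun i : 'I_j.+1 => (j.+1 - i)%:R * ((f (nseq i 0%N) / i`!%:R)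
      * (g (nseq (j.+1 - i)%N 0%N) / (j.+1 - i)`!%:R)))); last first.
  by move=> i _; rewrite lderivE mulrCA subSn // -ltnS.
transitivity (\sum_(i < j.+2) (i%:R + (j.+1 - i)%:R) * ((f (nseq i 0%N) / i`!%:R)
      * (g (nseq (j.+1 - i)%N 0%N) / (j.+1 - i)`!%:R))).
  under [RHS]eq_bigr do rewrite mulrDl.
  rewrite big_split /=; congr (_ + _).
    rewrite [RHS]big_ord_recl mul0r add0r; apply: eq_bigr => i _.
    by rewrite lift0 subSS !mulrA.
  by rewrite [RHS]big_ord_recr /= subnn mul0r addr0.
rewrite mulr_sumr; apply: eq_bigr => i _.
by rewrite -natrD subnKC // -ltnS.
Qed.

(** A substitution is a ring morphism, and [adjoin] is its expansion in x_0. *)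
Lemma adjoin_shuffle j f g s :
  adjoin j (shuffle f g) s =
    \sum_(i < j.+1) shuffle (adjoin i f) (adjoin (j - i) g) s.
Proof.
elim: s j f g => [|a s IH] j f g /=; first exact: shuffle_nseq.
have lderivM b : lderiv b (shuffle f g) =1
    (fun t => shuffle (lderiv b f) g t + shuffle f (lderiv b g) t) by [].
rewrite (eq_adjoin _ _ (lderivM a)) adjoinD !IH.
have -> : (if j is j'.+1 then adjoin j' (lderiv a.+1 (shuffle f g)) s else 0) =
    (if j is j'.+1 then adjoin j' (shuffle (lderiv a.+1 f) g) s
       + adjoin j' (shuffle f (lderiv a.+1 g)) s else 0).
  by case: j => // j; rewrite (eq_adjoin _ _ (lderivM _)) adjoinD.
have lderiv_adjoin i (h : seq nat -> R) t : lderiv a (adjoin i h) t =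
  adjoin i (lderiv a h) t + (if i is i'.+1 then adjoin i' (lderiv a.+1 h) t else 0).
  by [].
under [RHS]eq_bigr => i _ do rewrite
  (eq_shuffle (fun t _ => lderiv_adjoin i f t) (fun t _ => erefl (adjoin (j - i) g t)))
  shuffleDl
  (eq_shuffle (fun t _ => erefl (adjoin i f t)) (fun t _ => lderiv_adjoin (j - i)%N g t))
  shuffleDr.
rewrite !big_split /= -!addrA; congr (_ + _).
rewrite [RHS]addrCA; congr (_ + _).
have zl h : shuffle (fun=> 0) h s = 0 by exact: shuffle0l.
have zr h : shuffle h (fun=> 0) s = 0 by exact: shuffle0r.
case: j => [|j]; first by rewrite !big_ord1 subnn zl zr addr0.
rewrite big_ord_recl /= zl add0r [X in _ = _ + X]big_ord_recr /= subnn zr addr0.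
by congr (_ + _); rewrite IH; apply: eq_bigr => i _ //; rewrite subSn // -ltnS.
Qed.

Lemma adjoin_zero j s : adjoin j (fun=> 0) s = 0.
Proof.
elim: s j => [|a s IH] j /=; first by rewrite mul0r.
have lderiv_zero b : lderiv b (fun=> 0) = fun=> 0 by [].
by rewrite lderiv_zero IH add0r; case: j => // j; rewrite lderiv_zero IH.
Qed.

(** The coefficient of the monomial with exponents m 0, ..., m (N - 1): the
variables are adjoined one by one, and what remains is evaluated at 0. *)
Fixpoint sym_coef (N : nat) (m : nat -> nat) f : R :=
  if N is N'.+1 then sym_coef N' m (adjoin (m N') f) else f [::].

(** Adjoining a variable preserves the grading by weight, so a coefficient only
sees the words of one weight.  This is what makes infinite expansions
finite. *)
Lemma eq_sym_coef N m m' f f' :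
    (forall i, (i < N)%N -> m i = m' i) ->
    (forall t, lweight t = (\sum_(i < N) m i)%N -> f t = f' t) ->
  sym_coef N m f = sym_coef N m' f'.
Proof.
elim: N f f' => [|N IH] f f' mm' ff' /=; first by rewrite ff' ?big_ord0.
apply: IH => [i iN|t tw]; first by rewrite mm' // ltnW.
rewrite mm' //; apply: eq_adjoin_weight => u uw; apply: ff'.
by rewrite uw tw big_ord_recr /= mm'.
Qed.

Lemma sym_coefD N m f f' :
  sym_coef N m (fun s => f s + f' s) = sym_coef N m f + sym_coef N m f'.
Proof.
elim: N f f' => [//|N IH] f f' /=; rewrite -IH.
by apply: eq_sym_coef => // t _; rewrite adjoinD.
Qed.

Lemma sym_coefZ N m c f : sym_coef N m (fun s => c * f s) = c * sym_coef N m f.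
Proof.
elim: N f => [//|N IH] f /=; rewrite -IH.
by apply: eq_sym_coef => // t _; rewrite adjoinZ.
Qed.

Lemma sym_coef_zero N m : sym_coef N m (fun=> 0) = 0.
Proof.
elim: N => //= N IH; rewrite -[RHS]IH.
by apply: eq_sym_coef => // t _; exact: adjoin_zero.
Qed.

Lemma sym_coef_sum (I : Type) (r : seq I) N m (c : I -> R) (F : I -> seq nat -> R) :
  sym_coef N m (fun s => \sum_(i <- r) c i * F i s) =
  \sum_(i <- r) c i * sym_coef N m (F i).
Proof.
elim: r => [|i r IH].
  rewrite big_nil -[RHS](sym_coef_zero N m).
  by apply: eq_sym_coef => // t _; rewrite big_nil.
rewrite big_cons -IH -sym_coefZ -sym_coefD.
by apply: eq_sym_coef => // t _; rewrite big_cons.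
Qed.

(** The series y_k, with y_0 = 1. *)
Definition letter (k : nat) s : R :=
  if k is a.+1 then (s == [:: a])%:R else (s == [::])%:R.

Lemma lderiv_letter0 a : lderiv a (letter 0) =1 fun=> 0.
Proof. by []. Qed.

Lemma lderiv_letterS a k : lderiv a (letter k.+1) =1 fun s => (a == k)%:R * letter 0 s.
Proof. by move=> s; rewrite /lderiv /letter eqseq_cons -natrM mulnb. Qed.

Lemma adjoinS_letter0 j s : adjoin j.+1 (letter 0) s = 0.
Proof.
by case: s => [|a s] /=; rewrite ?mul0r // !(eq_adjoin _ _ (lderiv_letter0 _)) !adjoin_zero addr0.
Qed.

Lemma adjoin1_letterS k s : adjoin 1 (letter k.+1) s = letter k s.
Proof.
case: s => [|a s] /=; first by rewrite divr1; case: k.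
rewrite !(eq_adjoin _ _ (lderiv_letterS _ _)) !adjoinZ adjoinS_letter0 mulr0 add0r.
by rewrite adjoin0; case: k => [|k]; rewrite ?mul0r //= eqSS eqseq_cons -natrM mulnb.
Qed.

Lemma adjoinSS_letter j k s : adjoin j.+2 (letter k) s = 0.
Proof.
case: k => [|k]; first exact: adjoinS_letter0.
case: s => [|a s] /=; first by rewrite eqseq_cons andbF mul0r.
by rewrite !(eq_adjoin _ _ (lderiv_letterS _ _)) !adjoinZ !adjoinS_letter0 !mulr0 addr0.
Qed.

(** Adjoining x_0 sends y_k to y_k + x_0 y_(k-1), so each variable is used at
most once and lowers the index by one; y_0 is what has to remain. *)
Lemma sym_coef_letter N m k :
  sym_coef N m (letter k) =
    ([forall i : 'I_N, m i <= 1]%N && (\sum_(i < N) m i == k)%N)%:R.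
Proof.
elim: N k => [|N IH] k /=.
  rewrite big_ord0 (_ : [forall i : 'I_0, _]); last by apply/forallP => -[].
  by case: k.
have -> : [forall i : 'I_N.+1, m i <= 1]%N = [forall i : 'I_N, m i <= 1]%N && (m N <= 1)%N.
  apply/forallP/andP => [mN|[/forallP mN mN1] i].
    by split; [apply/forallP => i; exact: (mN (widen_ord (leqnSn N) i))|exact: (mN ord_max)].
  have [iN|] := ltnP i N; first exact: (mN (Ordinal iN)).
  by move=> Ni; have -> : i = N :> nat by apply/eqP; rewrite eqn_leq Ni -ltnS ltn_ord.
rewrite big_ord_recr /=; case: (m N) => [|[|j]] /=.
- by rewrite andbT addn0 -IH; apply: eq_sym_coef => // t _; exact: adjoin0.
- case: k => [|k].
    rewrite addn1 andbF -[RHS](sym_coef_zero N m).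
    by apply: eq_sym_coef => // t _; exact: adjoinS_letter0.
  rewrite andbT addn1 eqSS -IH.
  by apply: eq_sym_coef => // t _; exact: adjoin1_letterS.
- rewrite andbF -[RHS](sym_coef_zero N m).
  by apply: eq_sym_coef => // t _; exact: adjoinSS_letter.
Qed.

Definition perm_inv f := forall s t, perm_eq s t -> f s = f t.

Lemma perm_inv_lderiv a f : perm_inv f -> perm_inv (lderiv a f).
Proof. by move=> fS s t st; apply: fS; rewrite perm_cons. Qed.

(** By the Leibniz rule one letter a is consumed by the first factor; there are
as many choices as occurrences of a, all equivalent by symmetry. *)
Lemma shuffle_letterS a g s : perm_inv g ->
  shuffle (letter a.+1) g s = (count_mem a s)%:R * g (rem a s).
Proof.
have shuffle1 h t : shuffle (letter 0) h t = h t.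
  elim: t h => [|b t IH] h /=; first by rewrite mul1r.
  by rewrite IH shuffle0l // add0r.
elim: s g => [|b s IH] g gS /=; first by rewrite !mul0r.
rewrite IH; last exact: perm_inv_lderiv.
rewrite (eq_shuffle (fun t _ => lderiv_letterS b a t) (fun t _ => erefl (g t))).
rewrite shuffleZl shuffle1 natrD mulrDl; case: eqP => [->|_]; last first.
  by rewrite !mul0r.
rewrite !mul1r; congr (_ + _).
have [as_|aNs] := boolP (a \in s); last by rewrite (count_memPn aNs) !mul0r.
by congr (_ * _); apply: gS; rewrite perm_sym perm_to_rem.
Qed.

(** The product of the factorials of the multiplicities.  The recursion matches
the one of [shuffle_letterS]. *)
Fixpoint multfact s : nat :=
  if s is a :: s' then ((count_mem a s').+1 * multfact s')%N else 1%N.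

(** The derivatives of the monomial in the y_k with the letters of u. *)
Definition orbit_ind u s : R := (multfact u * perm_eq s u)%:R.

Lemma perm_inv_orbit_ind u : perm_inv (orbit_ind u).
Proof. by move=> s t /permPl st; rewrite /orbit_ind st. Qed.

Lemma shuffle_orbit_ind a u : shuffle (letter a.+1) (orbit_ind u) =1 orbit_ind (a :: u).
Proof.
move=> s; rewrite shuffle_letterS; last exact: perm_inv_orbit_ind.
rewrite /orbit_ind -natrM; congr _%:R.
have [as_|aNs] := boolP (a \in s); last first.
  rewrite (count_memPn aNs) mul0n; case: (boolP (perm_eq s _)) => [/perm_mem/(_ a)|].
    by rewrite inE eqxx (negbTE aNs).
  by rewrite muln0.
rewrite (permPl (perm_to_rem as_)) perm_cons.
have [/permP su|] := boolP (perm_eq (rem a s) u); last by rewrite !muln0.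
rewrite !muln1 /= -su; congr (_ * _)%N.
by rewrite (permP (perm_to_rem as_)) /= eqxx add1n.
Qed.

End Shuffle.

(** * Injectivity of the expansion *)

Section Injectivity.
Context {R : numFieldType}.
Implicit Types (f g : seq nat -> R) (s : seq nat).

(** Iterated derivatives commute, so only adjacent letters need to be swapped;
the four terms of two successive steps are permuted. *)
Lemma perm_inv_adjoin j f : perm_inv f -> perm_inv (adjoin j f).
Proof.
have swap i h a b s : perm_inv h ->
    adjoin i h (a :: b :: s) = adjoin i h (b :: a :: s).
  move=> hS /=.
  have lderivC c d : lderiv c (lderiv d h) =1 lderiv d (lderiv c h).
    by move=> t; apply: hS; rewrite -[d :: c :: t]/([:: d] ++ [:: c] ++ t) perm_catCA.
  rewrite (eq_adjoin _ _ (lderivC b a)).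
  case: i => [|i]; first by rewrite !addr0.
  rewrite (eq_adjoin _ _ (lderivC b.+1 a)) (eq_adjoin _ _ (lderivC b a.+1)).
  rewrite !addrA -!(addrA (adjoin _ _ s)); congr (_ + _); rewrite !addrA.
  case: i => [|i]; first by rewrite !addr0 addrC.
  by rewrite (eq_adjoin _ _ (lderivC b.+1 a.+1)) [X in X + _]addrC.
have front i h a u v : perm_inv h ->
    adjoin i h (u ++ a :: v) = adjoin i h (a :: u ++ v).
  elim: u i h => [//|b u IH] i h hS; rewrite swap //.
  rewrite [LHS]/= [RHS]/=; congr (_ + _); last case: i => // i;
    apply: IH; exact: perm_inv_lderiv.
move=> fS s t; elim: s t j f fS => [|a s IH] t j f fS.
  by rewrite perm_sym => /perm_nilP ->.
move=> st; have at_ : a \in t by rewrite -(perm_mem st) mem_head.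
case/splitPr: t / at_ st => u v st.
have {}st : perm_eq s (u ++ v) by rewrite -(perm_cons a) (permPl st) -cat1s perm_catCA.
rewrite front //=; congr (_ + _); last case: j => // j;
  apply: IH => //; exact: perm_inv_lderiv.
Qed.

(** Every increment of a letter and every new letter costs one factor x_0, so
the words contributing to x_0^j have length at least j. *)
Lemma adjoin_eq0 j f s :
    (forall t, (j <= size t)%N -> lweight t = (lweight s + j)%N -> f t = 0) ->
  adjoin j f s = 0.
Proof.
elim: s j f => [|a s IH] j f f0 /=.
  by rewrite f0 ?mul0r ?size_nseq // lweight_nseq0.
rewrite IH ?add0r; last first.
  move=> t jt tw; apply: f0; first exact: leqW.
  by rewrite !lweight_cons tw addnA.
case: j f0 => // j f0; apply: IH => t jt tw; apply: f0 => //.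
by rewrite !lweight_cons tw; lia.
Qed.

(** The shortest contribution: all letters are incremented and r new ones are
added, using all the size s + r factors x_0. *)
Lemma adjoin_top r f s :
    (forall t, (size s + r < size t)%N ->
       lweight t = (lweight s + (size s + r))%N -> f t = 0) ->
  adjoin (size s + r) f s = f (map succn s ++ nseq r 0%N) / r`!%:R.
Proof.
elim: s f => [//|a s IH] f f0 /=.
rewrite adjoin_eq0 ?add0r; last first.
  move=> t jt tw; apply: f0; first by rewrite /= ltnS.
  by rewrite !lweight_cons tw /=; lia.
rewrite IH // => t jt tw; apply: f0 => //=.
by rewrite !lweight_cons tw; lia.
Qed.

Lemma size_lweight s : (size s <= lweight s)%N.
Proof. by elim: s => //= a s IH; rewrite lweight_cons; lia. Qed.

(** Algebraic independence of the e_k.  By induction on the weight, all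
[adjoin j f] with j > 0 vanish.  The words are then treated by decreasing
length: a word of length n with r letters 0 is a rearrangement of the
shortest word occurring in [adjoin n f] at the word of its remaining letters,
each lowered by one ([adjoin_top]), and the other words occurring there are
longer. *)
Lemma perm_inv_sym_coef_inj d f : perm_inv f ->
    (forall N (m : nat -> nat), (\sum_(i < N) m i)%N = d -> sym_coef N m f = 0) ->
  forall s, lweight s = d -> f s = 0.
Proof.
have [n] := ubnP d; elim: n d f => // n IH d f; rewrite ltnS => dn fS f0.
have adjoin_f0 j s : (0 < j)%N -> (lweight s + j)%N = d -> adjoin j f s = 0.
  move=> j0 sd; apply: (IH (lweight s)) => //; [lia|exact: perm_inv_adjoin|].
  move=> N m mw; pose m' i := if i == N then j else m i.
  have m'E i : (i < N)%N -> m' i = m i by move=> iN; rewrite /m' ltn_eqF.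
  rewrite -[RHS](f0 N.+1 m').
    by rewrite /= {2}/m' eqxx; apply: eq_sym_coef => // i iN; rewrite m'E.
  rewrite big_ord_recr /= {2}/m' eqxx -sd -mw; congr (_ + _)%N.
  by apply: eq_bigr => i _; rewrite m'E.
(* k counts how far the length of s is from exceeding the weight d, which is
   impossible as every letter weighs at least 1. *)
suff f_size k s : lweight s = d -> (d < size s + k)%N -> f s = 0.
  by move=> s sd; apply: (f_size d.+1) => //; lia.
elim: k s => [|k IHk] s sd sk; first by have := size_lweight s; lia.
have [u [r us]] : exists u r, perm_eq s (map succn u ++ nseq r 0%N).
  exists [seq a.-1 | a <- s & a != 0%N], (count_mem 0%N s).
  rewrite -map_comp map_id_in => [|a]; last first.
    by rewrite mem_filter => /andP[]; case: a.
  rewrite perm_sym perm_catC -(permPr (permEl (perm_filterC (pred1 0%N) s))) perm_cat2r.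
  by rewrite (all_pred1P _ _ (filter_all (pred1 0%N) s)) size_filter.
have [s0|s_gt0] := posnP (size s).
  move/size0nil: s0 => s0; move: sd; rewrite s0 => d0.
  by rewrite -(f0 0%N (fun=> 0%N)) // big_ord0.
have ss : (size u + r)%N = size s by rewrite (perm_size us) size_cat size_map size_nseq.
have sw : lweight s = (lweight u + (size u + r))%N.
  rewrite /lweight (perm_sumn (perm_map succn us)) map_cat sumn_cat map_nseq sumn_nseq.
  rewrite -/(lweight _) mul1n addnA; congr (_ + _)%N.
  by elim: (u) => //= a v IHv; rewrite !lweight_cons IHv; lia.
apply/eqP; have := adjoin_f0 (size s) u s_gt0.
rewrite -ss -sw sd => /(_ erefl); rewrite adjoin_top => [/eqP|t tu tw].
  by rewrite mulf_eq0 invr_eq0 pnatr_eq0 -leqn0 leqNgt fact_gt0 orbF (fS _ _ us).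
by apply: IHk; lia.
Qed.

End Injectivity.

(** * Expansions in elementary symmetric functions *)

Section Expansion.
Context {R : realType}.
Implicit Types (f g : seq nat -> R) (s : seq nat) (m : monomial).
Local Open Scope classical_set_scope.

Definition below N m := forall i, (N <= i)%N -> m i = 0%N.

Lemma big_finsupp (T : Type) (idx : T) (op : Monoid.com_law idx) (F : nat -> T) N m :
    below N m -> (forall i, m i = 0%N -> F i = idx) ->
  \big[op/idx]_(i <- finsupp m) F i = \big[op/idx]_(i < N) F i.
Proof.
move=> mN F1; rewrite -(big_mkord xpredT F) [RHS](bigID (mem (finsupp m))) /=.
rewrite [X in op _ X]big1 ?Monoid.mulm1 => [|i iNm]; last first.
  by apply: F1; exact: fsfun_dflt.
rewrite -[RHS]big_filter; apply: perm_big; apply: uniq_perm => [||i].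
- exact: fset_uniq.
- by rewrite filter_uniq ?iota_uniq.
rewrite mem_filter mem_index_iota /= andb_idr // => im.
rewrite ltnNge; apply/negP => /mN mi; move: im.
by rewrite mem_finsupp mi eqxx.
Qed.

Lemma mdegree_below N m : below N m -> mdegree m = (\sum_(i < N) m i)%N.
Proof. by move=> mN; rewrite /mdegree (big_finsupp _ (F := m) mN). Qed.

(** The factorizations of m are pairs of an exponent i <= m N for the first
factor and a factorization of m without its last variable; [adjoin_shuffle]
has the same shape. *)
Lemma sym_coef_shuffle N m f g : below N m ->
  sym_coef N m (shuffle f g) =
    \sum_(p \in mfactors m) sym_coef N p.1 f * sym_coef N p.2 g.
Proof.
elim: N m f g => [|N IH] m f g mN /=.
  rewrite (_ : mfactors m = [set (m, m)]) ?fsbig_set1 //.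
  have m0 i : m i = 0%N by exact: mN.
  apply/seteqP; split => [[p q] /= pqm|_ -> i]; last by rewrite /= m0.
  have pm : p = m by apply/fsfunP => i; have := pqm i; rewrite /= m0; lia.
  have qm : q = m by apply/fsfunP => i; have := pqm i; rewrite /= m0; lia.
  by rewrite pm qm.
pose m' : monomial := [fsfun m with N |-> 0%N].
have m'N : below N m'.
  by move=> i iN; rewrite fsfun_withE; case: eqP => // /eqP ni; apply: mN; lia.
have sym_coef_m' (p p' : monomial) h : (forall i, (i < N)%N -> p i = p' i) ->
    sym_coef N p h = sym_coef N p' h.
  by move=> pp'; exact: eq_sym_coef.
have -> : sym_coef N m (adjoin (m N) (shuffle f g)) =
    \sum_(i < (m N).+1) \sum_(p \in mfactors m')
       sym_coef N p.1 (adjoin i f) * sym_coef N p.2 (adjoin (m N - i) g).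
  rewrite (eq_sym_coef (m' := m') (f' := fun s => \sum_(i < (m N).+1)
     1 * shuffle (adjoin i f) (adjoin (m N - i) g) s)); last 2 first.
  - by move=> i iN; rewrite fsfun_withE ltn_eqF.
  - by move=> t _; rewrite adjoin_shuffle; apply: eq_bigr => i _; rewrite mul1r.
  by rewrite sym_coef_sum; apply: eq_bigr => i _; rewrite mul1r; exact: IH.
rewrite (fsbig_ord _ _ (fun i => \sum_(p \in mfactors m')
   sym_coef N p.1 (adjoin i f) * sym_coef N p.2 (adjoin (m N - i) g))).
rewrite pair_fsbig; [|exact: finite_II|exact: finite_mfactors].
pose h (x : nat * (monomial * monomial)) : monomial * monomial :=
  ([fsfun x.2.1 with N |-> x.1], [fsfun x.2.2 with N |-> (m N - x.1)%N]).
rewrite (reindex_fsbig h (`I_(m N).+1 `*` mfactors m')) /=.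
  apply: eq_fsbigr => -[i [p q]] _ /=; rewrite !fsfun_with; congr (_ * _).
    by apply: sym_coef_m' => k kN; rewrite fsfun_withE ltn_eqF.
  by apply: sym_coef_m' => k kN; rewrite fsfun_withE ltn_eqF.
have mfactors_N p : mfactors m' p -> p.1 N = 0%N /\ p.2 N = 0%N.
  by move/(_ N); rewrite fsfun_with; lia.
split.
- move=> [i [p q]] [/= iN pq] k; rewrite /h /= !fsfun_withE; case: eqP => [->|kN].
    by rewrite subnKC // -ltnS.
  by have := pq k; rewrite /= fsfun_withE; case: eqP.
- move=> [i [p q]] [i' [p' q']]; rewrite !in_setE /= => -[_ pq] [_ pq'] [/fsfunP E1 /fsfunP E2].
  have ii' : i = i' by have := E1 N; rewrite !fsfun_with.
  have [/= pN qN] := mfactors_N _ pq; have [/= pN' qN'] := mfactors_N _ pq'.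
  have -> : p = p'.
    by apply/fsfunP => k; have := E1 k; rewrite !fsfun_withE; case: eqP => [->|]; rewrite ?pN.
  have -> : q = q'.
    by apply/fsfunP => k; have := E2 k; rewrite !fsfun_withE; case: eqP => [->|]; rewrite ?qN.
  by rewrite ii'.
- move=> [p q] /= pq.
  exists (p N, ([fsfun p with N |-> 0%N], [fsfun q with N |-> 0%N])); last first.
    rewrite /h /=; congr pair; apply/fsfunP => k; rewrite !fsfun_withE; case: eqP => // ->.
      by [].
    have pqN : (p N + q N = m N)%N := pq N.
    by rewrite -pqN addKn.
  split => /=; first by have := pq N => /= pN; rewrite ltnS -pN leq_addr.
  by move=> k /=; rewrite !fsfun_withE; case: eqP => // _; exact: pq.
Qed.

Lemma below_mfactors N m p : below N m -> mfactors m p -> below N p.1 /\ below N p.2.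
Proof. by move=> mN pm; split => i /mN; have := pm i; lia. Qed.

Lemma sym_coef_elem_sym N m k : below N m -> sym_coef N m (letter k) = elem_sym k m :> R.
Proof.
move=> mN; rewrite sym_coef_letter /elem_sym; congr (_%:R); congr nat_of_bool.
have m1E : [forall i : 'I_N, (m i <= 1)%N] = all (fun i => m i == 1%N) (finsupp m).
  apply/forallP/allP => [m1 i|m1 i].
    rewrite mem_finsupp => mi; have [iN|/mN] := ltnP i N; last by lia.
    by have := m1 (Ordinal iN); rewrite /= -lt0n in mi *; lia.
  by have [->//|mi] := eqVneq (m i) 0%N; rewrite (eqP (m1 i _)) // mem_finsupp.
rewrite m1E andbC; case: allP => [m1|]; last by rewrite !andbF.
rewrite !andbT -(mdegree_below mN) /mdegree big_seq (eq_bigr (fun=> 1%N)) => [|i /m1/eqP//].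
by rewrite -big_seq sum1_size.
Qed.

Definition letters (la : seq nat) := [seq k.-1 | k <- la].

Lemma sym_coef_elem_sym_prod N m (s : seq nat) : below N m -> all (leq 1) s ->
  sym_coef N m (orbit_ind (letters s)) =
    (\big[mseries_mul/mseries_one]_(k <- s) elem_sym k) m :> R.
Proof.
elim: s m => [|[//|a] s IH] m mN /=.
  rewrite big_nil => _; rewrite (_ : mseries_one m = elem_sym 0 m).
    rewrite -(sym_coef_elem_sym _ mN); apply: eq_sym_coef => // t _.
    by rewrite /orbit_ind mul1n; congr (_%:R); congr nat_of_bool; apply/perm_nilP/eqP.
  rewrite /mseries_one /elem_sym cardfs_eq0; case: eqP => //= ->.
  by congr _%:R; apply/esym/eqP; rewrite eqb1; apply/allP.
move=> s1; rewrite big_cons /mseries_mul.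
rewrite (eq_sym_coef (m' := m) (f' := shuffle (letter a.+1) (orbit_ind (letters s)))) //.
  rewrite sym_coef_shuffle //; apply: eq_fsbigr => p; rewrite in_setE => pm.
  have [p1 p2] := below_mfactors mN pm.
  by rewrite sym_coef_elem_sym // IH.
by move=> t _; rewrite shuffle_orbit_ind.
Qed.

Lemma intpart_all (la : intpart) : all (leq 1) la.
Proof. by case: la => s /= /andP[]. Qed.

Lemma intpart_sorted (la : intpart) : sorted geq la.
Proof. by case: la => s /= /andP[]. Qed.

Lemma lettersK (s : seq nat) : all (leq 1) s -> map succn (letters s) = s.
Proof. by elim: s => //= -[//|k] s IH /= /IH ->. Qed.

Lemma lweight_letters (la : intpart) : lweight (letters la) = part_weight la.
Proof. by rewrite /lweight lettersK // intpart_all. Qed.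

Fact is_intpart_sort (t : seq nat) : is_intpart (sort geq (map succn t)).
Proof.
apply/andP; split; first by apply: sort_sorted => x y; exact: leq_total.
by rewrite all_sort all_map; apply/allP.
Qed.

Definition intpart_of t : intpart := IntPart (is_intpart_sort t).

Lemma letters_intpart_of t : perm_eq (letters (intpart_of t)) t.
Proof.
rewrite /letters /= -[X in perm_eq _ X](mapK succnK) perm_map //.
by rewrite perm_sort.
Qed.

Lemma perm_letters_inj (la mu : intpart) :
  perm_eq (letters la) (letters mu) -> la = mu.
Proof.
move=> /(perm_map succn); rewrite !lettersK ?intpart_all // => lamu.
apply: val_inj; apply: (sorted_eq _ _ (intpart_sorted la) (intpart_sorted mu)) => //.
  by move=> a b c; rewrite /geq /= => ba cb; exact: leq_trans cb ba.
by move=> a b; rewrite /geq /= andbC => /anti_leq.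
Qed.

Lemma multfact_gt0 s : (0 < multfact s)%N.
Proof. by elim: s => //= a s IH; rewrite muln_gt0. Qed.

(** A symmetric function on words is a combination of indicators of orbits.  The
indicator of the orbit of u is the monomial in the y_k with the letters of u,
divided by [multfact u], and as y_k = e_k this monomial expands as e_la. *)
Lemma sym_coef_perm_inv N m f : below N m -> perm_inv f ->
  sym_coef N m f =
    \sum_(la \in [set: intpart])
       f (letters la) / (multfact (letters la))%:R * elem_sym_part la m.
Proof.
move=> mN fS; pose A := fset_set [set la | part_weight la = mdegree m].
have AE la : (la \in A) = (part_weight la == mdegree m).
  rewrite in_fset_set; last exact: finite_part_weight.
  by apply/idP/eqP; rewrite in_setE.
(* Only partitions of the degree of m contribute. *)
rewrite (fsbigTE A) => [|la]; last first.
  rewrite AE => law; apply/eqP; rewrite mulf_eq0; apply/orP; right.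
  by apply: contraNT law => /elem_sym_part_homog ->.
transitivity (sym_coef N m (fun s => \sum_(la <- A)
    f (letters la) / (multfact (letters la))%:R * orbit_ind (letters la) s)).
  apply: eq_sym_coef => // t tw.
  rewrite (big_fsetD1 (intpart_of t)) /=; last first.
    rewrite AE -lweight_letters (mdegree_below mN) -tw /lweight.
    by rewrite (perm_sumn (perm_map _ (letters_intpart_of t))).
  rewrite big_seq big1 => [|la]; last first.
    rewrite in_fsetD1 => /andP[lat _]; rewrite /orbit_ind.
    case: (boolP (perm_eq t _)) => [tla|]; last by rewrite muln0 mulr0.
    case/eqP: lat; apply: perm_letters_inj.
    by rewrite (permPr (letters_intpart_of t)) perm_sym.
  rewrite addr0 /orbit_ind perm_sym letters_intpart_of muln1 divfK.
    by apply: fS; rewrite perm_sym letters_intpart_of.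
  by rewrite pnatr_eq0 -lt0n multfact_gt0.
rewrite sym_coef_sum; apply: eq_bigr => la _; congr (_ * _).
by rewrite (sym_coef_elem_sym_prod mN) // intpart_all.
Qed.

(** Two expansions give two symmetric functions on words with equal
coefficients. *)
Lemma chern_expansion_unique (Q : complex_genus R) b b' :
  chern_expansion Q b -> chern_expansion Q b' -> b = b'.
Proof.
move=> bQ b'Q; apply/funext => la.
pose F (c : intpart -> R) s := c (intpart_of s) * (multfact (letters (intpart_of s)))%:R.
have intpart_of_perm s t : perm_eq s t -> intpart_of s = intpart_of t.
  move=> st; apply: perm_letters_inj; rewrite (permPl (letters_intpart_of s)).
  by rewrite (permPr (letters_intpart_of t)).
have intpart_ofK (mu : intpart) : intpart_of (letters mu) = mu.
  exact/perm_letters_inj/letters_intpart_of.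
have FS c : perm_inv (F c) by move=> s t /intpart_of_perm; rewrite /F => ->.
have FE c : chern_expansion Q c -> forall N m, below N m ->
    sym_coef N m (F c) = prod_series Q m.
  move=> cQ N m mN; rewrite (sym_coef_perm_inv mN (FS c)) cQ.
  apply: eq_fsbigr => mu _; rewrite /F intpart_ofK mulfK //.
  by rewrite pnatr_eq0 -lt0n multfact_gt0.
pose G s := F b s + -1 * F b' s.
have GS : perm_inv G by move=> s t st; rewrite /G !(FS _ _ _ st).
suff /eqP : G (letters la) = 0.
  rewrite /G /F intpart_ofK mulN1r subr_eq0 => /eqP/mulIf; apply.
  by rewrite pnatr_eq0 -lt0n multfact_gt0.
apply: (perm_inv_sym_coef_inj GS) (erefl _) => N e _.
pose m : monomial := [fsfun i in [fset i in iota 0 N]%fset => e i].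
have mN : below N m.
  move=> i iN; rewrite fsfunE in_fset mem_iota /= add0n ltnNge iN //.
rewrite (eq_sym_coef (m' := m) (f' := G)) //; last first.
  by move=> i iN; rewrite fsfunE in_fset mem_iota /= add0n iN.
by rewrite sym_coefD sym_coefZ !FE // mulN1r subrr.
Qed.

End Expansion.

(** * Exponentials and set partitions *)

Section SetPartitions.
Context {R : numFieldType} {T : finType}.
Implicit Types (g : {set T} -> R) (D B : {set T}).

Definition partition_sum g D : R :=
  \sum_(P : {set {set T}} | finset.partition P D) \prod_(B in P) g B.

Lemma partition_sum0 g : partition_sum g finset.set0 = 1.
Proof.
rewrite /partition_sum (eq_bigl (pred1 finset.set0)) => [|P]; last exact: partition_set0.
by rewrite big_pred1_eq big_set0.
Qed.

(** The summation is organized by the block of x. *)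
Lemma partition_sum_rec g D x : x \in D ->
  partition_sum g D =
    \sum_(B : {set T} | (B \subset D) && (x \in B)) g B * partition_sum g (D :\: B).
Proof.
move=> xD; rewrite /partition_sum.
have blockP P : finset.partition P D -> pblock P x \in P /\ x \in pblock P x.
  by move=> PD; rewrite pblock_mem ?mem_pblock ?(cover_partition PD).
rewrite (partition_big (fun P => pblock P x) (fun B => (B \subset D) && (x \in B))); last first.
  by move=> P PD; have [BP xB] := blockP _ PD; rewrite (partitionS PD).
apply: eq_bigr => B /andP[BD xB]; rewrite mulr_sumr.
have BNP' P' : finset.partition P' (D :\: B) -> B \notin P'.
  move=> P'D; apply/negP => /(partitionS P'D)/fintype.subsetP/(_ x xB).
  by rewrite inE xB.
rewrite (reindex_onto (fun P' => B |: P') (fun P => P :\ B)); last first.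
  move=> P /andP[PD /eqP xP]; apply: setD1K; rewrite -xP.
  by have [] := blockP _ PD.
apply: eq_big => [P'|P' /andP[_ /eqP BP']]; last first.
  by rewrite big_setU1 //= -BP' setD11.
apply/andP/idP => [[/andP[BP'D _] /eqP <-]|P'D].
  by apply: partitionD1 => //; exact: setU11.
have BP'D : finset.partition (B |: P') D.
  rewrite -(setID D B) (setIidPr BD).
  apply: partitionU1 => //; first by apply/finset.set0Pn; exists x.
  by rewrite -setI_eq0 setIDA setIC setDIl setDv setI0 //.
split; last by rewrite setU1K // BNP'.
by rewrite BP'D (def_pblock (partition_trivIset BP'D) (setU11 _ _) xB) eqxx.
Qed.

Lemma sum_subsets_with (F : {set T} -> R) D x : x \notin D ->
  \sum_(B : {set T} | (B \subset x |: D) && (x \in B)) F B =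
    \sum_(B : {set T} | B \subset D) F (x |: B).
Proof.
move=> xD; rewrite [LHS](reindex_onto (fun B => x |: B) (fun B => B :\ x)) /=.
  apply: eq_bigl => B; rewrite setU11 andbT.
  apply/andP/idP => [[Br /eqP <-]|Br]; first by rewrite -(setU1K xD) setSD.
  split; first exact: setUS.
  by rewrite setU1K //; apply: contra xD => /(fintype.subsetP Br).
by move=> B /andP[_ xB]; exact: setD1K.
Qed.

(** Letters are labelled by distinct elements of T, so that subwords become
subsets: expanding the Leibniz rule distributes the labels over the two
factors. *)
Lemma shuffle_subsets (v : T -> nat) (f g : seq nat -> R) (r : seq T) : uniq r ->
  shuffle f g (map v r) =
    \sum_(B : {set T} | B \subset [set x in r])
       f [seq v x | x <- r & x \in B] * g [seq v x | x <- r & x \notin B].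
Proof.
elim: r f g => [|x r IH] f g /=.
  rewrite (eq_bigl (pred1 finset.set0)) ?big_pred1_eq // => B.
  by rewrite /= -subset0; congr (_ \subset _); apply/setP => y; rewrite !inE.
move=> /andP[xr ur]; rewrite !IH // [RHS](bigID (fun B : {set T} => x \in B)) /=.
have xE : [set y in x :: r] = x |: [set y in r] by apply/setP => y; rewrite !inE.
have xNr : x \notin [set y in r] by rewrite inE.
congr (_ + _); last first.
  apply: eq_big => [B|B /fintype.subsetP Br].
    rewrite xE; apply/idP/andP => [Br|[Br xB]].
      split; first exact: fintype.subset_trans Br (subsetUr _ _).
      by apply: contra xNr => /(fintype.subsetP Br).
    by rewrite -(setU1K xNr) subsetD1 Br.
  have xB : x \notin B by apply: contra xNr => /Br.
  by rewrite (negbTE xB).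
rewrite xE sum_subsets_with //; apply: eq_bigr => B _.
rewrite setU11 /= /lderiv.
have yE y : y \in r -> (y \in x |: B) = (y \in B).
  by move=> yr; rewrite !inE; case: eqP => // yx; rewrite -yx yr in xr.
by congr (f (_ :: _) * g _); congr map; apply: eq_in_filter => y /yE ->.
Qed.

End SetPartitions.

Section Exponential.
Context {R : numFieldType}.
Implicit Types (f g L : seq nat -> R) (s : seq nat).

(** The solution of the differential equations dF = dL F with F(0) = 1.  The
recursion goes from F at shorter words to F, which is not structural; n
bounds the length of the words. *)
Fixpoint exp_upto L (n : nat) s : R :=
  if s is a :: s' then
    if n is n'.+1 then shuffle (lderiv a L) (exp_upto L n') s' else 0
  else 1.

Definition exp_series L s : R := exp_upto L (size s) s.

Lemma lderiv_exp_series L a :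
  lderiv a (exp_series L) =1 shuffle (lderiv a L) (exp_series L).
Proof.
have upto n s : (size s <= n)%N -> exp_upto L n s = exp_series L s.
  have [k] := ubnP (size s); elim: k s n => // k IH [|a' s] [|n] //=.
  rewrite !ltnS => sk sn; rewrite /exp_series /=.
  apply: eq_shuffle => // t ts; rewrite !IH //; lia.
by move=> s; apply: eq_shuffle => // t ts; exact: upto.
Qed.

(** The formula of Faa di Bruno for the exponential.  The first letter belongs
to the block differentiating L in [lderiv_exp_series], and the shuffle
product chooses the other labels of this block: this is the recursion of
[partition_sum_rec]. *)
Lemma exp_series_partition (T : finType) (v : T -> nat) L (r : seq T) :
    uniq r ->
  exp_series L (map v r) =
    partition_sum (fun B => L [seq v x | x <- r & x \in B]) [set x in r].
Proof.
have [n] := ubnP (size r); elim: n r => // n IH [|x r].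
  move=> _ _; rewrite (_ : [set y in [::]] = finset.set0) ?partition_sum0 //.
rewrite ltnS /= => rn /andP[xr ur].
rewrite -[LHS]/(lderiv (v x) (exp_series L) (map v r)) lderiv_exp_series.
rewrite shuffle_subsets // (partition_sum_rec _ (x := x)) ?inE ?eqxx //.
have xE : [set y in x :: r] = x |: [set y in r] by apply/setP => y; rewrite !inE.
have xNr : x \notin [set y in r] by rewrite inE.
rewrite {1}xE sum_subsets_with //; apply: eq_bigr => B _.
have yE y : y \in r -> (y \in x |: B) = (y \in B).
  by move=> yr; rewrite !inE; case: eqP => // yx; rewrite -yx yr in xr.
rewrite setU11 /= /lderiv; congr (L (_ :: _) * _).
  by congr map; apply: eq_in_filter => y /yE ->.
rewrite IH ?filter_uniq //; last first.
  by rewrite (leq_ltn_trans _ rn) // size_filter count_size.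
have DE : [set y in r | y \notin B] = [set y in x :: r] :\: (x |: B).
  by apply/setP => y; rewrite !inE andbC; case: eqP => [->|_] /=; rewrite ?(negbTE xr) ?andbF.
have -> : [set y in [seq y <- r | y \notin B]] = [set y in x :: r] :\: (x |: B).
  by rewrite -DE; apply/setP => y; rewrite !inE mem_filter andbC.
apply: eq_bigr => P PD; apply: eq_bigr => C CP; congr (L (map v _)).
have CD : C \subset [set y in r | y \notin B] by rewrite DE; exact: partitionS PD CP.
have xC : x \notin C.
  by apply/negP => /(fintype.subsetP CD); rewrite inE (negbTE xr).
rewrite (negbTE xC) -filter_predI; apply: eq_in_filter => y yr /=.
by apply: andb_idr => /(fintype.subsetP CD); rewrite inE => /andP[].
Qed.

(** The partition sum of [exp_series_partition] does not depend on the order in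
which the labels are listed. *)
Lemma perm_inv_exp_series L : perm_inv L -> perm_inv (exp_series L).
Proof.
move=> LS s t st; have [I It sE] := perm_iotaP 0%N st.
(* One label more than needed keeps the type of labels inhabited. *)
pose n := size t; pose v (i : 'I_n.+1) := nth 0%N t i.
have ordE (J : seq nat) : {subset J <= iota 0 n} ->
    map (nth 0%N t) J = map v (map inord J).
  move=> Jn; rewrite -map_comp; apply/eq_in_map => j /Jn.
  by rewrite mem_iota /= add0n /v => jn; rewrite inordK // ltnW.
have ord_uniq (J : seq nat) : {subset J <= iota 0 n} -> uniq J ->
    uniq (map (@inord n) J).
  move=> Jn uJ; rewrite map_inj_in_uniq // => i j /Jn + /Jn.
  rewrite !mem_iota /= !add0n => iN jN /(congr1 val) /=.
  by rewrite !inordK // ltnW.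
have In : {subset I <= iota 0 n} by move=> i; rewrite (perm_mem It).
have uI : uniq I by rewrite (perm_uniq It) iota_uniq.
have tE : t = map (nth 0%N t) (iota 0 n) by rewrite map_nth_iota0 // take_size.
rewrite sE {2}tE !ordE //; rewrite !exp_series_partition ?ord_uniq ?iota_uniq //.
have -> : [set x in map (@inord n) I] = [set x in map inord (iota 0 n)].
  by apply/setP => i; rewrite !inE (perm_mem (perm_map _ It)).
apply: eq_bigr => P _; apply: eq_bigr => B _; apply/LS/perm_map/perm_filter/perm_map.
exact: It.
Qed.

End Exponential.

(** * Exponential of a logarithm and the coefficients of a genus *)

Section LogSeries.
Context {R : numFieldType}.
Implicit Types (h a : nat -> R) (s : seq nat).

(** The derivatives of the sum over k of h_k times the coefficient of t^k in
- log(1 + y_1 t + y_2 t^2 + ...). *)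
Definition log_series h s : R :=
  (-1) ^+ size s * (size s).-1`!%:R * h (lweight s).

Lemma perm_inv_log_series h : perm_inv (log_series h).
Proof.
move=> s t st; rewrite /log_series (perm_size st) /lweight.
by rewrite (perm_sumn (perm_map succn st)).
Qed.

(** The derivative of the logarithm along p + 1 letters of total weight w: up to
a constant it comes from (1 + y_1 t + y_2 t^2 + ...)^-(p+1), whose base is
multiplied by 1 + x_0 t when x_0 is adjoined.  The binomial coefficients are
those of (1 + x_0 t)^-(p+1). *)
Lemma adjoin_log_tail h p w j s :
  adjoin j (fun t => (-1) ^+ (p.+1 + size t) * (p + size t)`!%:R * h (w + lweight t)%N) s =
    (-1) ^+ (p.+1 + size s + j) * ('C(p + j, j) * (p + size s)`!)%:R
      * h (w + lweight s + j)%N.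
Proof.
elim: s p w j => [|a s IH] p w j /=.
  rewrite size_nseq lweight_nseq0.
  have -> : ((p + j)`! = 'C(p + j, j) * p`! * j`!)%N.
    by rewrite -(bin_fact (leq_addl p j)) addnK -mulnA (mulnC p`!).
  rewrite !addn0 natrM !mulrA [LHS]mulrAC mulfK //.
rewrite (@eq_adjoin _ _ _ (fun t => (-1) ^+ (p.+2 + size t) * (p.+1 + size t)`!%:R
    * h (w + a.+1 + lweight t)%N)); last first.
  by move=> t; rewrite /lderiv /= lweight_cons !addnS !addSn addnA.
rewrite IH; case: j => [|j].
  by rewrite !bin0 addr0 lweight_cons !addnS !addSn !addnA.
rewrite (@eq_adjoin _ _ _ (fun t => (-1) ^+ (p.+2 + size t) * (p.+1 + size t)`!%:R
    * h (w + a.+2 + lweight t)%N)); last first.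
  by move=> t; rewrite /lderiv /= lweight_cons !addnS !addSn addnA.
rewrite IH lweight_cons.
rewrite (_ : w + a.+2 + lweight s + j = w + a.+1 + lweight s + j.+1)%N; last by lia.
rewrite (_ : w + (a.+1 + lweight s) + j.+1 = w + a.+1 + lweight s + j.+1)%N; last by lia.
rewrite -mulrDl; congr (_ * _).
rewrite (_ : p.+1 + j.+1 = (p + j.+1).+1)%N // binS (_ : p.+1 + j = p + j.+1)%N; last by lia.
rewrite (_ : p.+1 + (size s).+1 + j.+1 = (p.+2 + size s + j).+1)%N; last by lia.
rewrite (_ : p.+2 + size s + j.+1 = (p.+2 + size s + j).+1)%N; last by lia.
rewrite (_ : p + (size s).+1 = p.+1 + size s)%N; last by lia.
rewrite exprS mulnDl natrD; ring.
Qed.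

Lemma lderiv_log_series h b s :
  lderiv b (log_series h) s = (-1) ^+ (1 + size s) * (0 + size s)`!%:R * h (b.+1 + lweight s)%N.
Proof. by []. Qed.

(** Adjoining x_0 multiplies 1 + y_1 t + ... by 1 + x_0 t, so the logarithm
changes by a constant with respect to the y_k.  In coefficients this is the
case of one used letter in [adjoin_log_tail], where the two terms of [adjoin]
have opposite signs. *)
Lemma lderiv_adjoin_log_series h b j s :
  lderiv b (adjoin j (log_series h)) s = (j == 0%N)%:R * lderiv b (log_series h) s.
Proof.
case: j => [|j]; rewrite /lderiv; first by rewrite !adjoin0 mul1r.
rewrite mul0r /= !(eq_adjoin _ _ (lderiv_log_series _ _)) !adjoin_log_tail !add0n !binn.
rewrite (_ : b.+2 + lweight s + j = b.+1 + lweight s + j.+1)%N; last by lia.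
by rewrite -mulrDl addnS exprS !mul1n mulN1r mulNr addNr mul0r.
Qed.

(** The equation x a'(x) = a(x) * (sum of (-1)^k h_k x^k over k >= 1): the sign
is chosen so that h_k enters [log_series] without a sign depending on k. *)
Definition log_coefs a h :=
  forall n, n%:R * a n = \sum_(k < n) (-1) ^+ k.+1 * h k.+1 * a (n - k.+1)%N.

(** Differentiating the exponential along y_1 only, the equations of
[lderiv_exp_series] become the equation defining h. *)
Lemma exp_log_series_nseq a h n : a 0%N = 1 -> log_coefs a h ->
  exp_series (log_series h) (nseq n 0%N) / n`!%:R = a n.
Proof.
move=> a0 ah; have [k] := ubnP n; elim: k n => // k IH [|n] nk.
  by rewrite divr1 a0.
apply: (@mulfI _ n.+1%:R); first by rewrite pnatr_eq0.
rewrite ah factS natrM invfM mulrCA mulVKf ?pnatr_eq0 //.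
rewrite -[exp_series _ _]/(lderiv 0 (exp_series (log_series h)) (nseq n 0%N)).
rewrite lderiv_exp_series shuffle_nseq; apply: eq_bigr => i _; rewrite subSS IH; last first.
  by move: nk; rewrite ltnS; exact: leq_ltn_trans (leq_subr _ _).
congr (_ * _); rewrite lderiv_log_series size_nseq lweight_nseq0 !add0n !add1n.
by rewrite mulrAC mulfK // pnatr_eq0 -lt0n fact_gt0.
Qed.

(** Induction on the word: both sides satisfy the equations
[lderiv_exp_series], since adjoining x_0 does not change the derivatives of
the logarithm, and they agree at the empty word. *)
Lemma adjoin_exp_log_series a h j s : a 0%N = 1 -> log_coefs a h ->
  adjoin j (exp_series (log_series h)) s = a j * exp_series (log_series h) s.
Proof.
move=> a0 ah; have [n] := ubnP (size s); elim: n j s => // n IH j [|b s] sn.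
  by rewrite mulr1 -(exp_log_series_nseq j a0 ah).
rewrite /= !(eq_adjoin _ _ (lderiv_exp_series _ _)).
rewrite -[exp_series _ (b :: s)]/(lderiv b (exp_series (log_series h)) s) lderiv_exp_series.
set F := exp_series _; set L := log_series _.
transitivity (\sum_(i < j.+1) shuffle (lderiv b (adjoin i L)) (adjoin (j - i) F) s).
  rewrite (eq_bigr (fun i : 'I_j.+1 => shuffle (adjoin i (lderiv b L)) (adjoin (j - i) F) s +
     shuffle (fun t => if i : nat is i'.+1 then adjoin i' (lderiv b.+1 L) t else 0)
        (adjoin (j - i) F) s)); last by move=> i _; rewrite -shuffleDl.
  rewrite big_split /= -adjoin_shuffle; congr (_ + _).
  case: j => [|j]; first by rewrite big_ord1 shuffle0l.
  rewrite big_ord_recl shuffle0l // add0r (eq_adjoin _ _ (lderiv_exp_series _ _)).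
  by rewrite adjoin_shuffle; apply: eq_bigr => i _; rewrite lift0 subSS.
rewrite big_ord_recl big1 ?addr0 => [|i _]; last first.
  apply: shuffle0l => t; rewrite lderiv_adjoin_log_series lift0.
  by rewrite mul0r.
rewrite -shuffleZr subn0; apply: eq_shuffle => t ts.
  by rewrite lderiv_adjoin_log_series mul1r.
by apply: IH; exact: leq_ltn_trans ts sn.
Qed.

Lemma sym_coef_exp_log_series a h N (m : nat -> nat) : a 0%N = 1 -> log_coefs a h ->
  sym_coef N m (exp_series (log_series h)) = \prod_(i < N) a (m i).
Proof.
move=> a0 ah; elim: N => [|N IH]; first by rewrite big_ord0.
rewrite big_ord_recr /= mulrC -IH -sym_coefZ.
by apply: eq_sym_coef => // t _; exact: adjoin_exp_log_series.
Qed.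

End LogSeries.

Section Genus.
Context {R : realType}.
Implicit Types (Q : complex_genus R) (la : intpart).

Lemma below_exists m : exists N, below N m.
Proof.
exists (\max_(i <- finsupp m) i.+1)%N => i iN; apply: contraTeq iN => mi.
rewrite -ltnNge; apply: (leq_bigmax_seq (F := succn)) => //.
by rewrite mem_finsupp.
Qed.

Lemma chern_coefP Q b : chern_expansion Q b -> chern_coef Q = b.
Proof.
move=> bQ; rewrite /chern_coef; case: xgetP => [_ -> cQ|/(_ b)//].
exact: chern_expansion_unique cQ bQ.
Qed.

Lemma char_series0 Q : Q 0%N = 1.
Proof. by case: Q. Qed.

(** By uniqueness it suffices to check the expansion, that is, to adjoin the
variables one by one. *)
Lemma chern_coef_exp_series Q h la : log_coefs Q h ->
  chern_coef Q la = exp_series (log_series h) (letters la) / (multfact (letters la))%:R.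
Proof.
move=> Qh; pose b (mu : intpart) :=
  exp_series (log_series h) (letters mu) / (multfact (letters mu))%:R.
rewrite (@chern_coefP Q b) // => m; have [N mN] := below_exists m.
rewrite -(sym_coef_perm_inv mN); last exact/perm_inv_exp_series/perm_inv_log_series.
rewrite (sym_coef_exp_log_series _ _ (char_series0 Q) Qh) /prod_series.
by rewrite (big_finsupp _ (F := fun i => Q (m i)) mN) // => i ->; exact: char_series0.
Qed.

Lemma multfact_letters la :
  multfact (letters la) = (\prod_(1 <= i < (part_weight la).+1) (part_mult i la)`!)%N.
Proof.
rewrite /part_mult /part_weight; move: (intpart_all la) (leqnn (sumn la)).
move: {2 3}(sumn la) => n; elim: (parts la) n => [|[//|k] s IH] n /=.
  by move=> _ _; rewrite big1_seq.
move=> s1 sn; have kn : (k < n)%N := leq_trans (leq_addr _ _) sn.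
rewrite (IH n) //; last exact: leq_trans (leq_addl _ _) sn.
rewrite [RHS](bigD1_seq k.+1) ?iota_uniq ?mem_index_iota //= eqxx add1n factS.
rewrite (bigD1_seq k.+1) ?iota_uniq ?mem_index_iota //= mulnA.
congr (_.+1 * _ * _)%N.
  by rewrite count_map; apply: eq_in_count => -[|i] /=; [move/(allP s1)|].
by apply: eq_bigr => i ik; rewrite eq_sym (negbTE ik).
Qed.

Lemma chern_coef_set_partitions Q h la : log_coefs Q h ->
  chern_coef Q la =
    (\sum_(P : {set {set 'I_(size la)}} | finset.partition P [set: 'I_(size la)])
       \prod_(B in P) ((-1) ^+ #|B| * (#|B|.-1)`!%:R * h (block_weight B)))
    / (\prod_(1 <= i < (part_weight la).+1) (part_mult i la)`!)%:R.
Proof.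
move=> Qh; rewrite (chern_coef_exp_series _ Qh) multfact_letters; congr (_ / _).
pose v (i : 'I_(size la)) := (nth 0%N la i).-1.
have -> : letters la = map v (enum 'I_(size la)).
  by rewrite -[in LHS](mkseq_nth 0%N la) /letters /mkseq -val_enum_ord -!map_comp.
rewrite exp_series_partition ?enum_uniq //.
have -> : [set x in enum 'I_(size la)] = [set: 'I_(size la)].
  by apply/setP => i; rewrite !inE mem_enum.
apply: eq_bigr => P _; apply: eq_bigr => B _; rewrite /log_series size_map.
have -> : [seq x <- enum 'I_(size la) | x \in B] = enum B.
  by rewrite /enum_mem -filter_predI; apply: eq_filter => x /=; rewrite andbT.
rewrite -cardE; congr (_ * h _); rewrite /lweight /block_weight -map_comp sumnE big_map big_enum.
apply: eq_bigr => i _ /=; rewrite prednK //.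
exact: (allP (intpart_all la)) (mem_nth _ (ltn_ord i)).
Qed.

End Genus.

(** * Logarithmic derivatives of formal power series *)

Section LogDerivative.
Context {R : realType}.
Implicit Types (a b f g : nat -> R).

Lemma fps_mulC f g : fps_mul f g = fps_mul g f.
Proof.
apply/funext => n; rewrite /fps_mul (reindex_inj rev_ord_inj) /=.
by apply: eq_bigr => i _; rewrite mulrC subSS subKn // -ltnS.
Qed.

(** Truncation: products of series are compared as products of polynomials. *)
Lemma fps_mul_poly f g n m : (n < m)%N ->
  fps_mul f g n = ((\poly_(i < m) f i) * (\poly_(i < m) g i))`_n.
Proof.
move=> nm; rewrite coefM; apply: eq_bigr => i _; rewrite !coef_poly.
have -> : (i < m)%N by apply: leq_trans nm; exact: ltn_ord.
by have -> : (n - i < m)%N by apply: leq_ltn_trans nm; exact: leq_subr.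
Qed.

Lemma fps_mulA f g a : fps_mul f (fps_mul g a) = fps_mul (fps_mul f g) a.
Proof.
apply/funext => n; pose P (b : nat -> R) : {poly R} := \poly_(i < n.+1) b i.
have PE b i : (i <= n)%N -> (P b)`_i = b i by move=> i_n; rewrite coef_poly ltnS i_n.
transitivity ((P f * (P g * P a))`_n).
  rewrite coefM; apply: eq_bigr => i _; rewrite PE -1?ltnS //.
  by rewrite (fps_mul_poly _ _ (m := n.+1)) // ltnS leq_subr.
rewrite mulrA coefM; apply: eq_bigr => i _; rewrite PE ?leq_subr //.
by rewrite (fps_mul_poly _ _ (m := n.+1)).
Qed.

Lemma fps_mulDl f g a n :
  fps_mul (fun i => f i + g i) a n = fps_mul f a n + fps_mul g a n.
Proof. by rewrite /fps_mul -big_split; apply: eq_bigr => i _; rewrite /= mulrDl. Qed.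

Lemma fps_mul1 f : fps_mul (fun i => (i == 0%N)%:R) f = f.
Proof.
apply/funext => n; rewrite /fps_mul big_ord_recl big1 ?addr0 ?mul1r ?subn0 //.
by move=> i _; rewrite lift0 mul0r.
Qed.

(** g is the logarithmic derivative x f'(x) / f(x). *)
Definition logder f g := forall n, n%:R * f n = fps_mul g f n.

Lemma logder_mul f f' g g' : logder f g -> logder f' g' ->
  logder (fps_mul f f') (fun n => g n + g' n).
Proof.
move=> fg f'g' n; rewrite fps_mulDl fps_mulA (fps_mulC f) fps_mulA (fps_mulC f').
have -> : fps_mul g f = fun n => n%:R * f n by apply/funext.
have -> : fps_mul g' f' = fun n => n%:R * f' n by apply/funext.
rewrite (fps_mulC (fun n => n%:R * f' n)).
rewrite /fps_mul mulr_sumr -big_split; apply: eq_bigr => i _ /=.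
have -> : n%:R = i%:R + (n - i)%:R :> R by rewrite -natrD subnKC // -ltnS.
ring.
Qed.

(** From f f' = 1 one gets (theta f) f' = - g f f' = - g with theta = x d/dx, and
multiplying by f gives the claim. *)
Lemma logder_inv f f' g : (forall n, fps_mul f f' n = (n == 0%N)%:R) ->
  logder f' g -> logder f (fun n => - g n).
Proof.
move=> ff' f'g n.
have -> : fps_mul (fun n => - g n) f n = - fps_mul g f n.
  by rewrite /fps_mul -sumrN; apply: eq_bigr => i _; rewrite mulNr.
have ffE : fps_mul f f' = fun i => (i == 0%N)%:R by apply/funext.
pose df i := i%:R * f i.
have dff' k : fps_mul df f' k = - fps_mul g (fun i => (i == 0%N)%:R) k.
  apply/eqP; rewrite -addr_eq0 -ffE (fps_mulC f) fps_mulA.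
  have -> : fps_mul g f' = fun n => n%:R * f' n by apply/funext.
  have -> : fps_mul df f' k + fps_mul (fun n => n%:R * f' n) f k = k%:R * fps_mul f f' k.
    rewrite (fps_mulC (fun n => n%:R * f' n)) /fps_mul mulr_sumr -big_split; apply: eq_bigr => i _ /=.
    have -> : k%:R = i%:R + (k - i)%:R :> R by rewrite -natrD subnKC // -ltnS.
    rewrite /df; ring.
  by rewrite ffE; case: k => [|k]; rewrite ?mul0r ?mulr0.
rewrite -[LHS]/(df n) -[df]fps_mul1 -ffE fps_mulC (fps_mulC f) fps_mulA.
have -> : fps_mul df f' = fun k => - g k.
  by apply/funext => k; rewrite dff' fps_mulC fps_mul1.
by rewrite /fps_mul -sumrN; apply: eq_bigr => i _; rewrite mulNr.
Qed.

(** Newton's identities, as additivity of logarithmic derivatives: the factor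
1 + u x has the logarithmic derivative u x - u^2 x^2 + u^3 x^3 - ... *)
Lemma logder_prod (us : seq R) :
  logder (fun n => (\prod_(u <- us) (1 + u *: 'X) : {poly R})`_n)
    (fun n => if n is k.+1 then (-1) ^+ k * \sum_(u <- us) u ^+ n else 0).
Proof.
elim: us => [|u us IH].
  move=> n; rewrite big_nil coef1 /fps_mul big1 => [|[[|i] ?] _] /=.
  - by case: n => [|n]; rewrite ?mul0r ?mulr0.
  - by rewrite mul0r.
  - by rewrite big_nil mulr0 mul0r.
have logder_u : logder (fun n => (1 + u *: 'X : {poly R})`_n)
    (fun n => if n is k.+1 then (-1) ^+ k * u ^+ n else 0).
  move=> [|[|n]]; rewrite coefD coef1 coefZ coefX /fps_mul.
  - by rewrite mul0r big_ord1 mul0r.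
  - rewrite big_ord_recl big_ord1 /= mul0r !coefD !coef1 !coefZ !coefX /=. ring.
  rewrite !mulr0 addr0 mulr0 2!big_ord_recr /= big1 => [|i _]; last first.
    have -> : (n.+2 - i = (n - i).+2)%N by have := ltn_ord i; lia.
    by rewrite coefD coef1 coefZ coefX /= mulr0 addr0 mulr0.
  rewrite subnn subSn // subnn !coefD !coef1 !coefZ !coefX /= !exprS; ring.
have -> : (fun n => (\prod_(u <- u :: us) (1 + u *: 'X) : {poly R})`_n) =
    fps_mul (fun n => (1 + u *: 'X : {poly R})`_n)
            (fun n => (\prod_(u <- us) (1 + u *: 'X) : {poly R})`_n).
  by apply/funext => n; rewrite big_cons coefM.
move=> n; rewrite (logder_mul logder_u IH n); congr (fps_mul _ _ n).
by apply/funext => -[|k]; rewrite ?addr0 // big_cons mulrDr.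
Qed.

End LogDerivative.

(** * The finite product for sinh *)

Section Tangents.
Context {R : realType}.
Implicit Types (x t : R).

(** Pascal's rule, in the form matching the addition formulas. *)
Lemma sum_binS (c : nat -> R) t n :
  \sum_(k < n.+2) 'C(n.+1, k)%:R * c k * t ^+ k =
    \sum_(k < n.+1) 'C(n, k)%:R * c k * t ^+ k
    + t * \sum_(k < n.+1) 'C(n, k)%:R * c k.+1 * t ^+ k.
Proof.
rewrite big_ord_recl [X in _ = X + _]big_ord_recl !bin0 -!addrA; congr (_ + _).
transitivity (\sum_(i < n.+1) 'C(n, i.+1)%:R * c i.+1 * t ^+ i.+1
   + t * \sum_(k < n.+1) 'C(n, k)%:R * c k.+1 * t ^+ k).
  rewrite mulr_sumr -big_split; apply: eq_bigr => i _.
  by rewrite lift0 binS natrD exprS /=; ring.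
by congr (_ + _); rewrite big_ord_recr /= bin_small // !mul0r addr0.
Qed.

(** The real and imaginary parts of i^k are [cos_sign] and [sin_sign]. *)
Definition cos_sign k : R := if odd k then 0 else (-1) ^+ k./2.
Definition sin_sign k : R := if odd k then (-1) ^+ k./2 else 0.

(** De Moivre's formula divided by cos(x)^n, in real form. *)
Lemma cos_sin_natmul n x : cos x != 0 ->
  cos (n%:R * x) = cos x ^+ n * \sum_(k < n.+1) 'C(n, k)%:R * cos_sign k * tan x ^+ k /\
  sin (n%:R * x) = cos x ^+ n * \sum_(k < n.+1) 'C(n, k)%:R * sin_sign k * tan x ^+ k.
Proof.
move=> cx0; have sinE : sin x = tan x * cos x by rewrite /tan divfK.
have cS k : cos_sign k.+1 = - sin_sign k.
  rewrite /cos_sign /sin_sign /= uphalf_half; case: (odd k) => //=.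
    by rewrite add1n exprS mulN1r.
  by rewrite oppr0.
have sS k : sin_sign k.+1 = cos_sign k.
  by rewrite /cos_sign /sin_sign /= uphalf_half; case: (odd k).
elim: n => [|n [IHc IHs]].
  by rewrite !big_ord1 !mul0r cos0 sin0 !expr0 bin0 /cos_sign /sin_sign /=; split; ring.
rewrite -natr1 mulrDl mul1r cosD sinD IHc IHs !sum_binS sinE exprSr.
under [X in _ = _ * (_ + _ * X) /\ _]eq_bigr do rewrite cS mulrN mulNr.
under [X in _ /\ _ = _ * (_ + _ * X)]eq_bigr do rewrite sS.
by rewrite sumrN; split; ring.
Qed.

(** ((1 + z/N)^N - (1 - z/N)^N) / (2z) for N = 2M + 1, as a polynomial in z^2. *)
Definition sinh_poly M : {poly R} :=
  \poly_(j < M.+1) ('C(M.*2.+1, j.*2.+1)%:R / (M.*2.+1)%:R ^+ j.*2.+1).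

(** Numbered from r = 0, the angle being pi (r + 1) / N. *)
Definition cot_node M r : R := ((M.*2.+1)%:R * tan (pi * r.+1%:R / (M.*2.+1)%:R)) ^- 2.

Lemma angle_itv M r : (r < M)%N -> 0 < (pi : R) * r.+1%:R / (M.*2.+1)%:R < pi / 2.
Proof.
move=> rM; rewrite divr_gt0 ?mulr_gt0 ?pi_gt0 ?ltr0n //=.
rewrite -mulrA ltr_pM2l ?pi_gt0 // ltr_pdivrMr ?ltr0n // mulrC ltr_pdivlMr //.
by rewrite -natrM ltr_nat; lia.
Qed.

Lemma cos_gt0_quadrant x : 0 < x < pi / 2 -> 0 < cos x.
Proof.
move=> /andP[x0 xpi]; rewrite cos_gt0_pihalf // xpi (lt_trans _ x0) //.
by rewrite oppr_lt0 divr_gt0 // pi_gt0.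
Qed.

Lemma tan_gt0 x : 0 < x < pi / 2 -> 0 < tan x.
Proof.
by move=> xI; rewrite divr_gt0 ?sin_gt0_pihalf ?cos_gt0_quadrant.
Qed.

Lemma sin_pi_natmul n : sin (pi * n%:R) = 0 :> R.
Proof.
elim: n => [|n IH]; first by rewrite mulr0 sin0.
by rewrite -natr1 mulrDr mulr1 sinDpi IH oppr0.
Qed.

Lemma big_ord_double (F : nat -> R) n :
  \sum_(k < n.*2) F k = \sum_(j < n) (F j.*2 + F j.*2.+1).
Proof.
elim: n => [|n IH]; first by rewrite !big_ord0.
by rewrite doubleS !big_ord_recr /= IH addrA.
Qed.

(** At z = i N tan(x) the polynomial is sin(N x) up to a nonzero factor, and
sin(N x) = 0 for the angle x of the node. *)
Lemma sinh_poly_root M r : (r < M)%N -> root (sinh_poly M) (- (cot_node M r)^-1).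
Proof.
move=> rM; rewrite /cot_node; have xI := angle_itv rM; have t0 := tan_gt0 xI.
have N0 : (M.*2.+1)%:R != 0 :> R by rewrite pnatr_eq0.
have sinNx : sin ((M.*2.+1)%:R * (pi * r.+1%:R / (M.*2.+1)%:R)) = 0 :> R.
  by rewrite mulrC divfK // sin_pi_natmul.
move: sinNx t0 xI; set x := _ / _ => sinNx t0 /cos_gt0_quadrant cx.
have [_] := cos_sin_natmul M.*2.+1 (lt0r_neq0 cx).
rewrite sinNx => /esym/eqP; rewrite mulf_eq0 expf_eq0 (gt_eqF cx) andbF /=.
rewrite -doubleS (big_ord_double (fun k => 'C(M.*2.+1, k)%:R * sin_sign k * tan x ^+ k)).
move=> sum0; apply/eqP; rewrite horner_poly invrK.
apply: (@mulIf _ ((M.*2.+1)%:R * tan x)); first by rewrite mulf_neq0 // gt_eqF.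
rewrite mul0r -[RHS](eqP sum0) mulr_suml; apply: eq_bigr => j _.
rewrite /sin_sign /= odd_double /= mulr0 mul0r add0r uphalf_double.
rewrite (exprNn (_ ^+ 2)) -exprM mul2n exprMn !exprS.
have Nj0 : (M.*2.+1)%:R ^+ j.*2 != 0 :> R by rewrite expf_neq0.
move: N0 Nj0; set N := (M.*2.+1)%:R; set Nj := _ ^+ j.*2 => N0 Nj0.
by field; rewrite Nj0 nat1r.
Qed.

(** The difference of both sides has degree at most the number of u, and
vanishes at 0 and at all - 1/u. *)
Lemma prod_root_eq (p : {poly R}) (us : seq R) :
    uniq us -> 0 \notin us -> (size p <= (size us).+1)%N -> p.[0] = 1 ->
    (forall u, u \in us -> root p (- u^-1)) ->
  p = \prod_(u <- us) (1 + u *: 'X).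
Proof.
move=> uus us0 sp p0 pus; apply/eqP; rewrite -subr_eq0; apply/negPn/negP => d0.
have sprod : (size (\prod_(u <- us) (1 + u *: 'X) : {poly R})%R <= (size us).+1)%N.
  elim: us {uus us0 sp pus d0} => [|u us IH]; first by rewrite big_nil size_poly1.
  rewrite big_cons (leq_trans (size_polyMleq _ _)) //=.
  have : (size (1 + u *: 'X : {poly R})%R <= 2)%N.
    rewrite (leq_trans (size_polyD _ _)) // geq_max size_poly1 /=.
    by rewrite (leq_trans (size_scale_leq _ _)) // size_polyX.
  by move=> su; rewrite -subn1 leq_subLR (leq_trans (leq_add su IH)).
have horner_fact x : (\prod_(u <- us) (1 + u *: 'X)).[x] = \prod_(u <- us) (1 + u * x).
  by rewrite horner_prod; apply: eq_bigr => u _; rewrite !hornerE.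
suff : ((size us).+1 < size (p - \prod_(u <- us) (1 + u *: 'X))%R)%N.
  by rewrite ltnNge (leq_trans (size_polyD _ _)) // geq_max sp size_polyN.
have us_neq0 u : u \in us -> u != 0 by move=> uu; apply: contraNneq us0 => <-.
rewrite -[(size us).+1]/(size (0 :: us)) -(size_map (fun u => - u^-1)).
apply: (max_poly_roots d0) => /=.
  apply/andP; split.
    rewrite invr0 oppr0 rootE hornerD hornerN p0 horner_fact big1 ?subrr // => u _.
    by rewrite mulr0 addr0.
  apply/allP => _ /mapP[u uu ->]; rewrite rootE hornerD hornerN horner_fact.
  rewrite (rootP (pus u uu)) sub0r oppr_eq0 (bigD1_seq u) //=.
  by rewrite mulrN divff ?us_neq0 // subrr mul0r.
have inj : injective (fun u : R => - u^-1) by move=> u v /oppr_inj/invr_inj.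
by rewrite (mem_map inj) us0 map_inj_uniq.
Qed.

Lemma cot_node_gt0 M r : (r < M)%N -> 0 < cot_node M r.
Proof.
by move=> rM; rewrite invr_gt0 exprn_gt0 // mulr_gt0 ?ltr0n // tan_gt0 // angle_itv.
Qed.

Lemma sinh_poly_prod M :
  sinh_poly M = \prod_(u <- [seq cot_node M r | r <- iota 0 M]) (1 + u *: 'X).
Proof.
have N0 : (M.*2.+1)%:R != 0 :> R by rewrite pnatr_eq0.
apply: prod_root_eq.
- rewrite map_inj_in_uniq ?iota_uniq // => r q.
  rewrite !mem_iota !add0n /= => rM qM /invr_inj/eqP.
  have tr := tan_gt0 (angle_itv rM); have tq := tan_gt0 (angle_itv qM).
  have Nt0 x : 0 < tan x -> 0 <= (M.*2.+1)%:R * tan x :> R.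
    by move=> tx; apply: mulr_ge0 => //; exact: ltW.
  rewrite eqrXn2 ?Nt0 // => /eqP/(mulfI N0).
  have itv k : (k < M)%N -> (pi : R) * k.+1%:R / (M.*2.+1)%:R \in `](- (pi / 2)), (pi / 2)[.
    move=> /angle_itv/andP[x0 xpi]; rewrite in_itv /= xpi (lt_trans _ x0) //.
    by rewrite oppr_lt0 divr_gt0 // pi_gt0.
  move=> /(congr1 atan); rewrite !tanK ?itv //.
  move=> /(mulIf (invr_neq0 N0))/(mulfI (lt0r_neq0 (pi_gt0 R)))/eqP.
  by rewrite eqr_nat => /eqP[].
- apply/negP => /mapP[r]; rewrite mem_iota add0n => rM.
  by move/eqP; rewrite lt_eqF // cot_node_gt0.
- by rewrite size_map size_iota size_poly.
- by rewrite horner_coef0 coef_poly /= bin1 expr1 divff.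
- move=> u /mapP[r]; rewrite mem_iota add0n => rM ->; exact: sinh_poly_root.
Qed.

Lemma sinh_poly_newton M n :
  n%:R * (sinh_poly M)`_n =
    \sum_(j < n) (-1) ^+ j * (\sum_(0 <= r < M) cot_node M r ^+ j.+1)
       * (sinh_poly M)`_(n - j.+1).
Proof.
have := logder_prod [seq cot_node M r | r <- iota 0 M] n; rewrite -sinh_poly_prod => ->.
rewrite /fps_mul big_ord_recl mul0r add0r; apply: eq_bigr => j _; rewrite lift0.
by rewrite big_map /index_iota subn0.
Qed.

End Tangents.

(** * Even zeta values *)

Section Limits.
Context {R : realType}.
Implicit Types (x : R).

Lemma sin_le x : 0 <= x -> sin x <= x.
Proof.
move=> x0; have [|c _] := @MVT_segment R sin cos 0 x x0 (fun y _ => is_derive_sin y).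
  by apply: continuous_subspaceT => y; exact: continuous_sin.
rewrite sin0 !subr0 => ->; rewrite -[leRHS]mul1r ler_wpM2r // cos_le1.
Qed.

Lemma le_tan x : 0 <= x < pi / 2 -> x <= tan x.
Proof.
move=> /andP[x0 xpi].
have cos_gt0 y : y \in `[0, x] -> 0 < cos y.
  rewrite in_itv /= => /andP[y0 yx]; rewrite cos_gt0_pihalf //.
  rewrite (le_lt_trans yx) // andbT (lt_le_trans _ y0) //.
  by rewrite oppr_lt0 divr_gt0 // pi_gt0.
have [y yx||c cx] := @MVT_segment R tan (fun y => (cos y) ^- 2) 0 x x0.
- by apply: is_derive_tan; rewrite gt_eqF // cos_gt0 //; apply: subset_itv_oo_cc.
- apply: derivable_within_continuous => y yx.
  by apply: derivable_tan; rewrite gt_eqF // cos_gt0.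
rewrite tan0 !subr0 => ->; rewrite -[leLHS]mul1r ler_wpM2r //.
by rewrite invf_ge1 ?exprn_gt0 ?cos_gt0 // expr_le1 // ?cos_le1 // ltW // cos_gt0.
Qed.

Lemma tan_bounds x : 0 < x < pi / 2 -> x ^- 2 - 1 <= tan x ^- 2 <= x ^- 2.
Proof.
move=> xI; have /andP[x0 xpi] := xI.
have sx : 0 < sin x by rewrite sin_gt0_pihalf.
have tx := tan_gt0 xI.
have tanE : tan x ^- 2 = sin x ^- 2 - 1.
  rewrite /tan expr_div_n invf_div.
  apply: (@mulIf _ (sin x ^+ 2)); first by rewrite expf_neq0 // gt_eqF.
  by rewrite mulrBl mul1r divfK ?mulVf ?expf_neq0 ?gt_eqF // cos2sin2.
apply/andP; split.
  rewrite tanE lerD2r lef_pV2 ?posrE ?exprn_gt0 //.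
  by rewrite ler_pXn2r ?nnegrE ?(ltW sx) ?(ltW x0) // sin_le // ltW.
rewrite lef_pV2 ?posrE ?exprn_gt0 // ler_pXn2r ?nnegrE ?(ltW tx) ?(ltW x0) //.
by rewrite le_tan // xpi ltW.
Qed.

Lemma cot_node_bounds M r : (r < M)%N ->
  ((pi : R) * r.+1%:R) ^- 2 - (M.*2.+1)%:R ^- 2 <= cot_node M r <= ((pi : R) * r.+1%:R) ^- 2.
Proof.
move=> rM; have := tan_bounds (angle_itv rM); rewrite /cot_node.
set N := (M.*2.+1)%:R; have N0 : 0 < N :> R by rewrite ltr0n.
rewrite [in X in X -> _]expr_div_n invf_div => /andP[t1 t2].
have N2 : 0 < N ^- 2 by rewrite invr_gt0 exprn_gt0.
have NK : N ^- 2 * N ^+ 2 = 1 by rewrite mulVf // expf_neq0 // gt_eqF.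
rewrite (exprMn 2 N) (invfM (N ^+ 2)); apply/andP; split.
  by have := ler_wpM2l (ltW N2) t1; rewrite mulrBr mulrA NK mul1r mulr1.
by have := ler_wpM2l (ltW N2) t2; rewrite mulrA NK mul1r.
Qed.

(** The mean value inequality for x^j on [0, 1]. *)
Lemma exprB_le (a b : R) j : 0 <= b -> b <= a -> a <= 1 ->
  a ^+ j - b ^+ j <= j%:R * (a - b).
Proof.
move=> b0 ba a1; have a0 := le_trans b0 ba; elim: j => [|j IH].
  by rewrite !expr0 subrr mul0r.
have -> : a ^+ j.+1 - b ^+ j.+1 = a * (a ^+ j - b ^+ j) + (a - b) * b ^+ j.
  by rewrite !exprS; ring.
rewrite -natr1 [leRHS]mulrDl mul1r lerD //.
  rewrite (le_trans _ IH) // ler_piMl // subr_ge0 lerXn2r //.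
by rewrite ler_piMr ?subr_ge0 // exprn_ile1 // (le_trans ba).
Qed.

Lemma pi_ge1 : 1 <= pi :> R.
Proof. by rewrite (le_trans _ (pi_ge2 R)) // ler1n. Qed.

Lemma nondecreasing_zeta_sum k :
  nondecreasing_seq (series (fun n => n.+1%:R ^- k : R)).
Proof.
apply/nondecreasing_seqP => n; rewrite -[in leRHS]addn1 /series /= addn1.
by rewrite big_nat_recr //= lerDl invr_ge0 exprn_ge0.
Qed.

(** The partial sums are bounded since 1 / (m + 1)^2 telescopes against
1/m - 1/(m + 1). *)
Lemma cvg_zeta k : (1 < k)%N ->
  (series (fun n => n.+1%:R ^- k : R) @ \oo --> zeta (k%:R : R))%classic.
Proof.
move=> k1; have zE : (fun n => n.+1%:R `^ (- k%:R)) = (fun n => n.+1%:R ^- k : R).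
  by apply/funext => n; rewrite powRN powR_mulrn.
rewrite /zeta zE; apply: nondecreasing_is_cvgn; first exact: nondecreasing_zeta_sum.
exists 2 => _ [n _ <-].
suff S M : series (fun n => n.+1%:R ^- k : R) M.+1 <= 2 - M.+1%:R^-1.
  case: n => [|n]; first by rewrite /series /= big_geq.
  by rewrite (le_trans (S n)) // gerBl invr_ge0.
rewrite /series /=; elim: M => [|M IH].
  by rewrite big_nat1 expr1n invr1; lra.
rewrite big_nat_recr //= (le_trans (lerD IH (lexx _))) //.
have M1 : 0 < M.+1%:R :> R by rewrite ltr0n.
have M2 : 0 < M.+2%:R :> R by rewrite ltr0n.
have : M.+2%:R ^- k <= M.+2%:R ^- 2 :> R.
  by rewrite lef_pV2 ?posrE ?exprn_gt0 // ler_weXn2l // ler1n.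
have : M.+2%:R ^- 2 <= M.+1%:R^-1 - M.+2%:R^-1 :> R.
  have -> : M.+1%:R^-1 - M.+2%:R^-1 = (M.+1%:R * M.+2%:R)^-1 :> R.
    by rewrite -(natr1 M.+1); field; rewrite nat1r natr1 !pnatr_eq0.
  by rewrite lef_pV2 ?posrE ?exprn_gt0 ?mulr_gt0 // expr2 ler_pM2r // ler_nat.
move=> h2 h1.
move: (M.+2%:R ^- k) (M.+2%:R ^- 2) (M.+1%:R^-1) (M.+2%:R^-1) h1 h2.
move=> a b c d; lra.
Qed.

Lemma zeta_gt0 k : (1 < k)%N -> 0 < zeta (k%:R : R).
Proof.
move=> k1; have zc := cvg_zeta k1.
have := nondecreasing_cvgn_le (@nondecreasing_zeta_sum k) (cvgP _ zc) 1%N.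
rewrite (cvg_lim _ zc) //.
by rewrite /series /= big_nat1 expr1n invr1; apply: lt_le_trans.
Qed.

(** Each of the M nodes differs from (pi (r + 1))^-2 by at most 1 / (2M + 1)^2, so
the power sums differ from the partial zeta sums by O(1/M). *)
Lemma cvg_cot_node_sum j :
  ((\sum_(0 <= r < M) cot_node M r ^+ j.+1) @[M --> \oo] -->
    zeta (j.+1.*2%:R : R) / pi ^+ j.+1.*2)%classic.
Proof.
pose Z M : R := series (fun n => n.+1%:R ^- j.+1.*2) M / pi ^+ j.+1.*2.
have cvgZ : (Z @ \oo --> zeta (j.+1.*2%:R : R) / pi ^+ j.+1.*2)%classic.
  by apply: cvgMr_tmp; apply: cvg_zeta.
have ZE M : Z M = \sum_(0 <= r < M) ((pi * r.+1%:R) ^- 2) ^+ j.+1.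
  rewrite /Z /series mulr_suml; apply: eq_bigr => r _.
  by rewrite exprVn -exprM mul2n exprMn (invfM (pi ^+ _)) mulrC.
apply: (squeeze_cvgr (f := fun M => Z M - j.+1%:R * harmonic M) (h := Z)) => //; last first.
  rewrite -[X in (_ --> X)%classic]subr0; apply: cvgB => //.
  by rewrite -(mulr0 j.+1%:R); apply: cvgMl_tmp; exact: cvg_harmonic.
near=> M; have pir r : 1 <= pi * r.+1%:R :> R.
  by rewrite -[leLHS]mulr1 ler_pM // ?pi_ge1 // ler1n.
have cot_nodeM r : (0 <= r < M)%N -> 0 <= (cot_node M r : R) <= (pi * r.+1%:R) ^- 2 /\
    ((pi : R) * r.+1%:R) ^- 2 - cot_node M r <= (M.*2.+1)%:R ^- 2.
  move=> /andP[_ rM]; have /andP[n1 n2] := cot_node_bounds rM.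
  by rewrite n2 ltW ?cot_node_gt0 //=; split => //; rewrite lerBlDr addrC -lerBlDr.
apply/andP; split; last first.
  rewrite ZE !big_nat; apply: ler_sum => r /cot_nodeM[/andP[n0 n1] _].
  by rewrite lerXn2r ?nnegrE // (le_trans n0).
rewrite lerBlDr -lerBlDl ZE -sumrB.
apply: (@le_trans _ _ (\sum_(0 <= r < M) j.+1%:R * (M.*2.+1)%:R ^- 2)).
  rewrite !big_nat; apply: ler_sum => r /cot_nodeM[/andP[n0 n1] n2].
  apply: le_trans (exprB_le _ n0 n1 _) _; last by rewrite ler_wpM2l.
  by rewrite invf_le1 ?exprn_gt0 ?exprn_ege1 // (lt_le_trans _ (pir r)).
rewrite sumr_const_nat subn0 -mulrnAr ler_wpM2l // /harmonic -mulr_natl.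
rewrite ler_pdivrMr ?exprn_gt0 ?ltr0n // ler_pdivlMl ?ltr0n //.
by rewrite -natrX -natrM ler_nat; lia.
Unshelve. all: by end_near. Qed.

(** The coefficient is 1 / (2n + 1)! times the product of 1 - i/N over i <= 2n,
each factor of which tends to 1. *)
Lemma cvg_sinh_poly_coef n :
  ((sinh_poly M)`_n @[M --> \oo] --> ((n.*2.+1)`!%:R : R)^-1)%classic.
Proof.
have cvg_ratio i : ((1 - i%:R / (M.*2.+1)%:R : R) @[M --> \oo] --> (1 : R))%classic.
  rewrite -[X in (_ --> X)%classic]subr0; apply: cvgB; first exact: cvg_cst.
  rewrite -(mulr0 i%:R); apply: cvgMl_tmp.
  apply: (squeeze_cvgr (f := fun=> 0) (h := harmonic)); [|exact: cvg_cst|exact: cvg_harmonic].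
  near=> M; rewrite invr_ge0 ler0n /= /harmonic /= lef_pV2 ?posrE ?ltr0n // ler_nat.
  by lia.
have cvg_ffact k : (((M.*2.+1 ^_ k)%:R / (M.*2.+1)%:R ^+ k : R) @[M --> \oo] --> (1 : R))%classic.
  elim: k => [|k IH].
    by under eq_fun do rewrite ffactn0 expr0 divr1; exact: cvg_cst.
  rewrite -[X in (_ --> X)%classic](mulr1 1).
  apply: cvg_trans (cvgM IH (cvg_ratio k)); apply: near_eq_cvg; near=> M.
  have kM : (k <= M.*2.+1)%N by near: M; exists k => // M /= kM; lia.
  rewrite /= ffactnSr natrM natrB // exprSr; field.
  by rewrite nat1r pnatr_eq0 expf_neq0 // pnatr_eq0.
have -> : ((n.*2.+1)`!%:R : R)^-1 = 1 / (n.*2.+1)`!%:R by rewrite mul1r.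
apply: cvg_trans (cvgMr_tmp (cvg_ffact n.*2.+1)); apply: near_eq_cvg; near=> M.
have nM : (n < M.+1)%N by near: M; exists n => // M /= nM; rewrite ltnS.
rewrite coef_poly nM -bin_ffact natrM mulrAC mulfK //.
Unshelve. all: by end_near. Qed.

(** The limit of Newton's identities for the finite products: this is the
logarithmic derivative of sinh(z) / z = prod_r (1 + z^2 / (pi r)^2). *)
Lemma zeta_newton n :
  n%:R / (n.*2.+1)`!%:R =
    \sum_(j < n) (-1) ^+ j * (zeta (j.+1.*2%:R : R) / pi ^+ j.+1.*2)
       / ((n - j.+1).*2.+1)`!%:R.
Proof.
have lhs : (n%:R * (sinh_poly M)`_n @[M --> \oo] --> n%:R / ((n.*2.+1)`!%:R : R))%classic.
  by apply: cvgMl_tmp; exact: cvg_sinh_poly_coef.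
have rhs : ((n%:R * (sinh_poly M)`_n : R) @[M --> \oo] -->
    \sum_(j < n) (-1) ^+ j * (zeta (j.+1.*2%:R : R) / pi ^+ j.+1.*2)
       / ((n - j.+1).*2.+1)`!%:R)%classic.
  under eq_fun do rewrite sinh_poly_newton.
  apply: (cvg_big (op := +%R)) => [|j _]; first exact: add_continuous.
  apply: cvgM; last exact: cvg_sinh_poly_coef.
  by apply: cvgMl_tmp; exact: cvg_cot_node_sum.
exact: cvg_unique lhs rhs.
Qed.

End Limits.

(** * Logarithmic derivative of the Todd series *)

Section Todd.
Context {R : realType}.

(** The coefficients h for the logarithmic derivative of x / (1 - e^-x), that is
1 + x/2 - (x/2) coth(x/2). *)
Definition todd_log k : R :=
  if k == 1%N then - 2^-1
  else if odd k then 0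
  else 2 * (-1) ^+ k./2 * zeta k%:R / (2 * pi) ^+ k.

(** The factorization (1 - e^-x) / x = e^(-x/2) * sinh(x/2) / (x/2) separates the
odd part -x/2 of the logarithmic derivative from the even one. *)
Definition exp_half n : R := (- 2^-1) ^+ n / n`!%:R.
Definition sinh_half n : R := if odd n then 0 else 2 ^- n / (n.+1)`!%:R.
Definition sinh_logder n : R :=
  if odd n || (n == 0%N) then 0 else - todd_log n.

(** The odd coefficients vanish by parity; for the even ones, [zeta_newton] is
used with z = x/2. *)
Lemma logder_sinh_half : logder sinh_half sinh_logder.
Proof.
move=> n; rewrite -[n in LHS]odd_double_half -[n in RHS]odd_double_half.
have [n1|n0] := boolP (odd n).
  rewrite /= add1n {1}/sinh_half /= odd_double /= mulr0 /fps_mul big1 // => i _.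
  rewrite /sinh_logder /sinh_half; case: ifP => [|/negbT]; first by rewrite mul0r.
  rewrite negb_or => /andP[i0 _]; rewrite oddB ?(ltnW (ltn_ord i)) -1?ltnS //.
  by rewrite /= odd_double /= (negbTE i0) /= mulr0.
rewrite add0n; move: (n./2) => k.
have -> : fps_mul sinh_logder sinh_half k.*2 =
    \sum_(j < k.+1) sinh_logder j.*2 * sinh_half (k.*2 - j.*2).
  pose F i := sinh_logder i * sinh_half (k.*2 - i).
  have F0 j : F j.*2.+1 = 0 by rewrite /F /sinh_logder /= odd_double mul0r.
  transitivity (\sum_(i < k.+1.*2) F i); last first.
    by rewrite big_ord_double; apply: eq_bigr => j _; rewrite F0 addr0.
  by rewrite doubleS [RHS]big_ord_recr /= F0 addr0.
rewrite big_ord_recl mul0r add0r.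
have E j : sinh_half j.*2 = 2 ^- j.*2 / (j.*2.+1)`!%:R by rewrite /sinh_half odd_double.
have pi2 : (2 : R) != 0 by [].
have -> : (k.*2)%:R * sinh_half k.*2 = 2 * 2 ^- k.*2 * (k%:R / (k.*2.+1)`!%:R).
  by rewrite E -mul2n natrM; ring.
rewrite zeta_newton mulr_sumr; apply: eq_bigr => j _; rewrite lift0.
rewrite -doubleB E /sinh_logder odd_double /= /todd_log /= odd_double doubleK.
rewrite exprS mulN1r (exprMn j.+1.*2) (invfM (2 ^+ _) (pi ^+ _)).
have -> : (2 : R) ^- k.*2 = 2 ^- j.+1.*2 * 2 ^- (k - j.+1).*2.
  by rewrite -invfM -exprD -doubleD subnKC.
rewrite negbK.
move: (2 ^- j.+1.*2) (2 ^- (k - j.+1).*2) (pi ^- j.+1.*2) (((k - j.+1).*2.+1)`!%:R^-1) => a b c d.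
by rewrite /=; ring.
Qed.

Lemma logder_exp_half : logder exp_half (fun n => (n == 1%N)%:R * - 2^-1).
Proof.
move=> [|n]; rewrite /fps_mul.
  by rewrite mul0r big_ord1 /= !mul0r.
rewrite 2!big_ord_recl big1 /= ?mul0r ?mul1r ?add0r ?addr0 => [|i _]; last first.
  by rewrite !mul0r.
rewrite subn1 /= /exp_half factS natrM exprS invfM; field.
by rewrite nat1r !pnatr_eq0 -lt0n fact_gt0.
Qed.

(** Up to (n + 1)!, both sides are the difference of the binomial expansions of
(1/2 - 1/2)^(n+1) and (-1/2 - 1/2)^(n+1). *)
Lemma todd_denom_factor : todd_denom R = fps_mul exp_half sinh_half.
Proof.
apply/funext => n.
have fact0 k : k`!%:R != 0 :> R by rewrite pnatr_eq0 -lt0n fact_gt0.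
apply: (mulfI (fact0 n.+1)); rewrite /todd_denom mulrCA mulfV ?fact0 // mulr1.
have h0 : 2^-1 + - 2^-1 = 0 :> R by rewrite subrr.
have h1 : - 2^-1 + - 2^-1 = -1 :> R by field.
transitivity ((2^-1 + - 2^-1) ^+ n.+1 - (- 2^-1 + - 2^-1 : R) ^+ n.+1).
  by rewrite h0 h1 expr0n exprS mulN1r sub0r opprK.
rewrite !exprDn -sumrB big_ord_recr /= subnn !expr0 subrr addr0.
rewrite /fps_mul mulr_sumr; apply: eq_bigr => i _.
have i_n : (i <= n)%N by rewrite -ltnS.
rewrite -mulrnBl -mulrBl -(bin_fact (leqW i_n)) !natrM subSn // /exp_half /sinh_half.
have -> : (2^-1 ^+ (n - i).+1 - (- 2^-1) ^+ (n - i).+1 : R) =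
    if odd (n - i) then 0 else 2 ^- (n - i).
  rewrite [in X in _ - X]exprNn -signr_odd /= -exprVn exprS.
  by case: (odd (n - i)) => /=; rewrite ?expr0 ?expr1; field.
rewrite -[LHS]mulr_natl; case: (odd (n - i)) => /=; first by rewrite !(mul0r, mulr0).
move: (fact0 i) (fact0 (n - i).+1) => f0 g0.
move: ('C(n.+1, i)%:R) ((- 2^-1) ^+ i) (2 ^- (n - i)) (i`!%:R) ((n - i).+1`!%:R) f0 g0.
by move=> c a b f g f0 g0; field; rewrite g0.
Qed.

Lemma log_coefs_todd : log_coefs (todd_series R) todd_log.
Proof.
have d0 : todd_denom R 0 != 0 by rewrite /todd_denom expr0 divr1 oner_neq0.
have QD n : fps_mul (todd_series R) (todd_denom R) n = (n == 0%N)%:R by exact: fps_mulVf.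
have := logder_mul logder_exp_half logder_sinh_half; rewrite -todd_denom_factor.
move=> /(logder_inv QD) Qlog n; rewrite Qlog /fps_mul big_ord_recl.
have log0 : - ((0%N == 1%N)%:R * - 2^-1 + sinh_logder 0) = 0 :> R.
  by rewrite /sinh_logder /= mul0r addr0 oppr0.
rewrite log0 mul0r add0r; apply: eq_bigr => i _; rewrite lift0; congr (_ * _).
rewrite /sinh_logder /todd_log eqSS orbF; case: i => -[|i] _ /=.
  by rewrite mul1r addr0 expr1 mulN1r.
rewrite mul0r add0r -(signr_odd _ i.+2) /= negbK; case: (odd i).
  by rewrite /= mulr0 oppr0.
by rewrite opprK expr0 mul1r.
Qed.

End Todd.

(** * The Todd coefficients without parts equal to 1 *)

Section ToddCoefficients.
Context {R : realType} (la : intpart) (m1 : part_mult 1 la = 0%N).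
Let l := size la.
Let w := part_weight la.
Implicit Types (P : {set {set 'I_l}}) (B : {set 'I_l}).

Lemma block_weight_gt1 B : B != finset.set0 -> (1 < block_weight B)%N.
Proof.
case/finset.set0Pn => i iB; rewrite /block_weight (bigD1 i) //=.
apply: leq_trans (leq_addr _ _).
have i_la : nth 0%N la i \in (la : seq nat) by rewrite mem_nth.
rewrite ltn_neqAle (allP (intpart_all la)) // andbT; apply/eqP => i1.
by move/eqP: m1; rewrite /part_mult -leqn0 leqNgt -has_count has_pred1 i1 i_la.
Qed.

Lemma sum_block_weight P : finset.partition P [set: 'I_l] ->
  (\sum_(B in P) block_weight B)%N = w.
Proof.
move=> Pl; rewrite /block_weight -(set_partition_big _ Pl) /=.
rewrite /w /part_weight sumnE (big_nth 0%N) big_mkord.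
by apply: eq_bigl => i; rewrite inE.
Qed.

Definition even_blocks P := [forall B in P, ~~ odd (block_weight B)].

Definition todd_block B : R :=
  (-1) ^+ #|B| * (#|B|.-1)`!%:R * todd_log (block_weight B).

(** A block of odd weight has weight at least 3, as no part is 1,
and h vanishes at odd numbers other than 1. *)
Lemma todd_block_odd P : finset.partition P [set: 'I_l] -> ~~ even_blocks P ->
  \prod_(B in P) todd_block B = 0.
Proof.
move=> Pl /forall_inPn[B BP]; rewrite negbK => Bodd.
have := block_weight_gt1 (partition_neq0 Pl BP); rewrite ltn_neqAle => /andP[B1 _].
by rewrite (bigD1 B) //= /todd_block /todd_log eq_sym (negbTE B1) Bodd mulr0 mul0r.
Qed.

Lemma odd_weight_blocks P : finset.partition P [set: 'I_l] -> even_blocks P -> ~~ odd w.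
Proof.
move=> Pl /forall_inP Pev; rewrite -(sum_block_weight Pl).
apply: (big_ind (fun n => ~~ odd n)) => // x y.
by rewrite oddD => /negbTE -> /negbTE ->.
Qed.

Definition zeta_term P : R :=
  2 ^+ #|P| * \prod_(B in P) ((#|B|.-1)`!%:R * zeta (block_weight B)%:R).

(** The signs and the powers of 2 pi of the blocks add up to quantities that
do not depend on P. *)
Lemma prod_todd_block P : finset.partition P [set: 'I_l] -> even_blocks P ->
  \prod_(B in P) todd_block B =
    (-1) ^+ (l + w./2) / (2 * pi) ^+ w * zeta_term P.
Proof.
move=> Pl /forall_inP Pev.
have lE : (-1 : R) ^+ l = \prod_(B in P) (-1) ^+ #|B|.
  by rewrite -expr_sum -(card_partition Pl) cardsT card_ord.
have wE : w./2 = (\sum_(B in P) (block_weight B)./2)%N.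
  apply: double_inj; rewrite -[RHS]mul2n big_distrr /=.
  rewrite halfK (negbTE (odd_weight_blocks Pl _)) ?subn0; last exact/forall_inP.
  rewrite -(sum_block_weight Pl); apply: eq_bigr => B /Pev Bev.
  by rewrite mul2n halfK (negbTE Bev) subn0.
rewrite exprD lE wE -[in X in _ / X](sum_block_weight Pl) !expr_sum /zeta_term.
rewrite -prodr_const -prodfV -!big_split /=; apply: eq_bigr => B BP.
have B1 := block_weight_gt1 (partition_neq0 Pl BP).
rewrite /todd_block /todd_log gtn_eqF // (negbTE (Pev _ BP)).
by move: (_ ^- block_weight B) => x; ring.
Qed.

Lemma zeta_term_gt0 P : finset.partition P [set: 'I_l] -> 0 < zeta_term P.
Proof.
move=> Pl; rewrite mulr_gt0 ?exprn_gt0 // prodr_gt0 // => B BP.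
rewrite mulr_gt0 ?ltr0n ?fact_gt0 // zeta_gt0 //.
exact: block_weight_gt1 (partition_neq0 Pl BP).
Qed.

(** All terms are positive, and the partition with at most one block is there. *)
Lemma sum_zeta_term_gt0 : ~~ odd w ->
  0 < \sum_(P | finset.partition P [set: 'I_l] && even_blocks P) zeta_term P.
Proof.
move=> w_even.
have [P0 P0l P0even] : exists2 P, finset.partition P [set: 'I_l] & even_blocks P.
  have [l0|l_neq0] := eqVneq [set: 'I_l] finset.set0.
    exists finset.set0; first by rewrite l0 partition_set0.
    by apply/forall_inP => B; rewrite inE.
  have trivial_partition : finset.partition [set [set: 'I_l]] [set: 'I_l].
    have := partitionU1 (P := finset.set0) (D := finset.set0) _ l_neq0.
    rewrite !finset.setU0; apply; first by rewrite partition_set0.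
    by rewrite -setI_eq0 finset.setI0.
  exists [set [set: 'I_l]] => //.
  apply/forall_inP => B; rewrite inE => /eqP ->.
  by have := sum_block_weight trivial_partition; rewrite big_set1 => ->.
rewrite (bigD1 P0) ?P0l ?P0even //=; apply: ltr_pwDl; first exact: zeta_term_gt0.
by apply: sumr_ge0 => P /andP[/andP[Pl _] _]; rewrite ltW // zeta_term_gt0.
Qed.

Lemma chern_coef_Td :
  chern_coef (Td R) la =
    (\sum_(P | finset.partition P [set: 'I_l] && even_blocks P)
       (-1) ^+ (l + w./2) / (2 * pi) ^+ w * zeta_term P)
    / (\prod_(1 <= i < w.+1) (part_mult i la)`!)%:R.
Proof.
rewrite (@chern_coef_set_partitions _ (Td R) todd_log la (@log_coefs_todd R)).
congr (_ / _); rewrite (bigID even_blocks) /= [X in _ + X]big1 ?addr0.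
  by apply: eq_bigr => P /andP[Pl Pev]; exact: prod_todd_block.
by move=> P /andP[Pl Podd]; exact: todd_block_odd.
Qed.

End ToddCoefficients.

Theorem proposition5p8 (R : realType) (la : intpart) (m1 : part_mult 1 la = 0%N) :
  let l := size la in
  let w := part_weight la in
  let sign : R := (-1) ^ (l%:Z - (w./2)%:Z) in
  (odd w -> chern_coef (Td R) la = 0) /\
  (~~ odd w ->
     chern_coef (Td R) la =
       sign / ((2 * pi) ^+ w * (\prod_(1 <= i < w.+1) (part_mult i la)`!)%:R) *
       (\sum_(P : {set {set 'I_l}} | finset.partition P [set: 'I_l]
                      && [forall B in P, ~~ odd (block_weight B)])
          (2 ^+ #|P| *
           \prod_(B in P) ((#|B|.-1)`!%:R * zeta (block_weight B)%:R)))
     /\ chern_coef (Td R) la != 0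
     /\ Num.sg (chern_coef (Td R) la) = sign).
Proof.
move=> l w sign; split => [w_odd|w_even].
  rewrite chern_coef_Td // big1 ?mul0r // => P /andP[Pl Pev].
  by have := odd_weight_blocks Pl Pev; rewrite w_odd.
(* The sign only depends on the parity of the exponent. *)
have signE : sign = (-1) ^+ (l + w./2).
  rewrite /sign expfzDr ?oppr_eq0 ?oner_eq0 // -exprz_inv invrN1 exprD.
  by [].
have S_gt0 := @sum_zeta_term_gt0 R la m1 w_even.
have mult_gt0 : 0 < (\prod_(1 <= i < w.+1) (part_mult i la)`!)%:R :> R.
  by rewrite ltr0n prodn_gt0 // => i; exact: fact_gt0.
have pi_gt0 : 0 < (2 * pi) ^+ w :> R by rewrite exprn_gt0 // mulr_gt0 // pi_gt0.
have formula : chern_coef (Td R) la =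
    sign / ((2 * pi) ^+ w * (\prod_(1 <= i < w.+1) (part_mult i la)`!)%:R)
    * \sum_(P | finset.partition P [set: 'I_l] && even_blocks P) zeta_term P.
  rewrite chern_coef_Td // -mulr_sumr signE invfM -/l -/w.
  by rewrite mulrAC !mulrA.
have sgE : Num.sg (chern_coef (Td R) la) = sign.
  rewrite formula sgrM (gtr0_sg S_gt0) mulr1 sgrM.
  by rewrite [X in _ * X]gtr0_sg ?invr_gt0 ?mulr_gt0 // mulr1 signE sgrX sgrN1.
split; first exact: formula.
by split=> //; rewrite -sgr_eq0 sgE signE signr_eq0.
Qed.
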